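(* Let $r$ be a positive integer and define $C_r:=\inf_{s\ge 1}p_{r,s}$, the infimum being over positive integers $s$. Then $$C_r=\min_{s\ge r}a_{r,s},$$ the minimum being over integers $s\ge r$. There is a unique real number $\sigma_r\in(r,\infty)$ satisfying $$(\sigma_r+1)\log\bigl((r+1)(\sigma_r+1)\bigr)=(r+\sigma_r+1)\log(r+\sigma_r+1).$$ If $k_r=\lfloor\sigma_r\rfloor$, then $$C_r=\min\{a_{r,k_r},\,a_{r,k_r+1}\}.$$ Moreover, with the infimum taken over real $\sigma\ge r$, $$\inf_{\sigma\ge r}\frac{\log(r+\sigma+1)}{\log(r+1)+\log(\sigma+1)}=\frac{\sigma_r+1}{r+\sigma_r+1}.$$
   Context: For an integer $n\ge 0$ and $0\le t\le 1$, put $G_n(t):=1+t+\cdots+t^n$. For positive integers $r,s$, a real number $p>0$ is called admissible for $(r,s)$ if $$G_{r+s}(t^p)\ge G_r(t)^p\,G_s(t)^p\qquad\text{for all }0\le t\le 1,$$ and $p=0$ is declared admissible as well. $p_{r,s}$ denotes the largest admissible exponent for $(r,s)$ (it exists: the set of admissible exponents is a closed bounded interval $[0,p_{r,s}]$). For positive integers $r,s$, $$a_{r,s}:=\frac{\log(r+s+1)}{\log(r+1)+\log(s+1)}.$$ *)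

(* Defs.v *)
From HB Require Import structures.
From mathcomp Require Import all_boot all_order all_algebra.
From mathcomp Require Import all_classical all_reals all_analysis.

Set Implicit Arguments.
Unset Strict Implicit.
Unset Printing Implicit Defensive.

Import Order.TTheory GRing.Theory Num.Theory.
Import numFieldTopology.Exports numFieldNormedType.Exports.

Local Open Scope classical_set_scope.
Local Open Scope ring_scope.

Definition geomG (R : realType) (n : nat) (t : R) : R := \sum_(i < n.+1) t ^+ i.

(* [0 `^ p = 0] for [0 < p], so [t = 0] is covered with the usual value. *)
Definition admissible (R : realType) (r s : nat) (p : R) : Prop :=
  p = 0 \/
  (0 < p /\ forall t : R, 0 <= t -> t <= 1 ->
     geomG r t `^ p * geomG s t `^ p <= geomG (r + s) (t `^ p)).

(* The largest admissible exponent; the supremum is attained, see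
   [max_exponentP]. *)
Definition max_exponent (R : realType) (r s : nat) : R :=
  sup [set p | @admissible R r s p].

(* [inf] is a genuine infimum here: the set is nonempty and bounded below by 0,
   since 0 is admissible. *)
Definition C_inf (R : realType) (r : nat) : R :=
  inf [set max_exponent R r s | s in [set s | (0 < s)%N]].

Definition a_quot (R : realType) (r s : nat) : R :=
  ln (r + s + 1)%:R / (ln (r + 1)%:R + ln (s + 1)%:R).

Definition is_minimum (R : realType) (A : set R) (m : R) : Prop :=
  A m /\ lbound A m.

Definition is_sigma (R : realType) (r : nat) (x : R) : Prop :=
  r%:R < x /\
  (x + 1) * ln ((r%:R + 1) * (x + 1)) = (r%:R + x + 1) * ln (r%:R + x + 1).

Lemma geomG1 (R : realType) n : geomG n (1 : R) = n.+1%:R.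
Proof.
rewrite /geomG (eq_bigr (fun=> 1)) => [|i _]; last by rewrite expr1n.
by rewrite sumr_const card_ord.
Qed.

Lemma geomG_gt0 (R : realType) n (t : R) : 0 <= t -> 0 < geomG n t.
Proof.
move=> t0; rewrite /geomG big_ord_recl expr0 ltr_pwDl ?ltr01//.
by apply: sumr_ge0 => i _; rewrite exprn_ge0.
Qed.

Lemma geomG0 (R : realType) n : geomG n (0 : R) = 1.
Proof.
rewrite /geomG big_ord_recl expr0 big1 ?addr0// => i _.
by rewrite expr0n.
Qed.

Lemma admissible_le (R : realType) (r s : nat) (p : R) :
  (0 < r)%N -> admissible r s p -> p <= a_quot R r s.
Proof.
move=> r0.
have D0 : 0 < ln (r + 1)%:R + ln (s + 1)%:R :> R.
  apply: ltr_wpDr; first by apply: ln_ge0; rewrite addn1 ler1n.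
  by apply: ln_gt0; rewrite addn1 ltr1n.
case=> [->|[p0 /(_ 1 ler01 (lexx _))]].
  by apply: divr_ge0; [apply: ln_ge0; rewrite addn1 ler1n | exact: ltW].
rewrite powR1 !geomG1 => H; rewrite /a_quot ler_pdivlMr// !addn1.
rewrite mulrDr -!ln_powR -lnM ?posrE ?powR_gt0 ?ltr0n//.
by rewrite ler_ln ?posrE ?mulr_gt0 ?powR_gt0 ?ltr0n.
Qed.

Lemma continuous_powR_exp (R : realType) (x : R) :
  0 < x -> continuous (fun p : R => x `^ p).
Proof.
move=> x0 p.
have -> : (fun p : R => x `^ p) = (fun p : R => expR (p * ln x)).
  by apply/funext => q; rewrite /powR gt_eqF.
apply: continuous_comp; last exact: continuous_expR.
by apply: cvgM; [exact: cvg_id | exact: cvg_cst].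
Qed.

Lemma continuous_geomG (R : realType) n : continuous (geomG n : R -> R).
Proof.
elim: n => [|n IH].
  have -> : geomG 0 = cst 1 :> (R -> R).
    by apply/funext => t; rewrite /geomG big_ord1 expr0.
  by move=> t; exact: cvg_cst.
have -> : geomG n.+1 = (fun t => geomG n t + t ^+ n.+1) :> (R -> R).
  by apply/funext => t; rewrite /geomG big_ord_recr.
by move=> t; apply: cvgD; [exact: IH | exact: exprn_continuous].
Qed.

Lemma max_exponentP (R : realType) (r s : nat) : (0 < r)%N ->
  admissible r s (max_exponent R r s) /\
  ubound [set p | admissible r s p] (max_exponent R r s).
Proof.
move=> r0.
set A := [set p : R | admissible r s p].
have A0 : A 0 by left.
have sA : has_sup A.
  by split; [exists 0 | exists (a_quot R r s) => p; exact: admissible_le].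
have ubA : ubound A (sup A) by exact: ub_le_sup (proj2 sA).
split; last exact: ubA.
rewrite /max_exponent -/A.
have [S0|S0] := eqVneq (sup A) 0; first by left.
have {}S0 : 0 < sup A by rewrite lt_def S0 ubA.
right; split=> // t t0 t1.
have [->|tn0] := eqVneq t 0.
  by rewrite powR0 ?gt_eqF// !geomG0 !powR1 mulr1.
have {}t0 : 0 < t by rewrite lt_def tn0.
pose f p := geomG (r + s) (t `^ p) - geomG r t `^ p * geomG s t `^ p.
have cf : continuous f.
  move=> p; apply: cvgB; last first.
    by apply: cvgM; apply: continuous_powR_exp; apply: geomG_gt0; exact: ltW.
  apply: continuous_comp; last exact: continuous_geomG.
  by apply: continuous_powR_exp.
rewrite -subr_ge0 -/(f _) leNgt; apply/negP => fS.
have /nbhs_ballP[e /= e0 He] : \forall p \near sup A, f p < 0.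
  exact: (cf (sup A) _ (lt_nbhsl fS)).
pose d := Num.min e (sup A).
have d0 : 0 < d by rewrite lt_min e0.
have [p Ap lp] := sup_adherent d0 sA.
have p0 : 0 < p by apply: le_lt_trans lp; rewrite subr_ge0 ge_min lexx orbT.
have : f p < 0.
  apply: He; rewrite /ball /= ger0_norm ?subr_ge0 ?ubA// ltrBlDr -ltrBlDl.
  by apply: le_lt_trans lp; rewrite lerB// ge_min lexx.
apply/negP; rewrite -leNgt subr_ge0.
case: Ap => [p00|[_ H]]; first by rewrite p00 ltxx in p0.
by apply: H => //; exact: ltW.
Qed.

(* Main.v *)
From HB Require Import structures.
From mathcomp Require Import all_boot all_order all_algebra.
From mathcomp Require Import all_classical all_reals all_analysis.
From mathcomp Require Import ring lra zify.
Require Import Defs.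

(** Let [p] be the minimum of [a_quot R r s] over [s >= r].  The value at [t = 1]
    shows that an admissible exponent for [(r, s)] is at most [a_quot R r s];
    hence [C_inf R r <= p], and everything rests on the converse, that [p] is
    admissible for [(r, s)] whatever [s] is.  The case [s < r] follows by symmetry
    from the case [s >= r], because the minimum can only decrease with [r]
    ([a_quot_lower_rows]).  For [s >= r] the range of [t] is cut in two.

    For small [t], the variable [b = t ^ (s + 1)] turns the inequality into
    [A (1 - b) ^ p + T b ^ p <= 1], where [A] and [T] do not depend on [s]
    ([admissible_atE]).  Two weighted arithmetic-geometric inequalities prove it
    for all [b] at once as soon as [(1 - t ^ p) G_r(t) ^ (2 p - 1) <= 1 - t]
    ([admissible_at_small]), and this holds up to an explicit threshold
    ([small_t_one], [threshold_below], [threshold_two], [threshold_large]).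

    For [t] near 1, put [t = exp (- 2 x)].  Then [ln G_n(t)] is an affine function
    of [x] plus a difference of values of [S(y) = ln (sinh y / y)], so that the
    logarithm of the quotient of the two sides is a combination of values of [S].
    At [x = 0] it is nonnegative because [p <= a_quot R r s]; its derivative is
    [p] times the combination [drift] of values of the Langevin function
    [L(y) = coth y - 1 / y].  The critical value of [s + 1] is
    [v = p r / (1 - p)].  When [s <= v] the drift is nonnegative: for
    [s >= r + 2] by concavity of [L] ([drift_near_critical]), and for [s = r] and
    [s = r + 1] by comparison with the Pade approximant [5 y / (15 + y ^ 2)], whose
    quotient into [L] is nondecreasing ([pade_ratio_nondecr],
    [langevin_comb_ge0]); what is left are polynomial inequalities.  When [s > v],
    the concave function of [b] above is past its maximum, and the inequality is
    inherited from the integer part of [v] ([admissible_at_mono],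
    [slope_of_langevin]).

    The estimates only use rational bounds on [p], obtained from the values of
    [a_quot] at one or two explicit points.  They come from the real function
    [log_quot r], which extends [a_quot R r]: the sign of its derivative is that
    of the increasing function [excess r], whose zero is [sigma_r], and at that
    zero [log_quot r x] equals [(x + 1) / (r + x + 1)].  The same monotonicity
    locates the minimum over the integers next to [sigma_r]. *)

Import Order.TTheory GRing.Theory Num.Theory.
Import numFieldTopology.Exports numFieldNormedType.Exports.

Local Open Scope classical_set_scope.
Local Open Scope ring_scope.

(** * Derivatives and hyperbolic functions *)

(** Locked, so that [sinh x] and [cosh x] are not matched as quotients. *)
HB.lock Definition sinh {R : realType} (x : R) : R := (expR x - expR (- x)) / 2.
HB.lock Definition cosh {R : realType} (x : R) : R := (expR x + expR (- x)) / 2.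

Section Derivatives.
Context {R : realType}.
Implicit Types (f g df : R -> R) (x y a b : R).

(** [is_derive] specialised to functions of one real variable, with the value
    of the derivative read in [R]. *)
Definition has_deriv f x (d : R) : Prop := is_derive x (1 : R) f d.

Lemma deriv_eq f x a b : has_deriv f x a -> a = b -> has_deriv f x b.
Proof. by move=> fa <-. Qed.

Lemma deriv_cst (c x : R) : has_deriv (fun _ => c) x 0.
Proof. exact: is_derive_cst. Qed.

Lemma deriv_id x : has_deriv (fun y : R => y) x 1.
Proof. exact: is_derive_id. Qed.

Lemma derivD f g x a b : has_deriv f x a -> has_deriv g x b ->
  has_deriv (fun y => f y + g y) x (a + b).
Proof. exact: is_deriveD. Qed.

Lemma derivB f g x a b : has_deriv f x a -> has_deriv g x b ->
  has_deriv (fun y => f y - g y) x (a - b).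
Proof. exact: is_deriveB. Qed.

Lemma derivM f g x a b : has_deriv f x a -> has_deriv g x b ->
  has_deriv (fun y => f y * g y) x (f x * b + g x * a).
Proof. exact: is_deriveM. Qed.

Lemma derivX f n x a : has_deriv f x a ->
  has_deriv (fun y => f y ^+ n) x (n%:R * f x ^+ n.-1 * a).
Proof.
move=> fa; have -> : (fun y => f y ^+ n) = f ^+ n by rewrite exprfctE.
exact: is_deriveX.
Qed.

Lemma deriv_comp f g x a b : has_deriv f (g x) a -> has_deriv g x b ->
  has_deriv (fun y => f (g y)) x (a * b).
Proof. exact: is_derive1_comp. Qed.

Lemma derivZ f k x a : has_deriv f x a -> has_deriv (fun y => k * f y) x (k * a).
Proof.
move=> fa; apply: deriv_eq; first exact: (derivM _ _ _ _ _ (deriv_cst k x) fa).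
by rewrite mulr0 addr0.
Qed.

Lemma deriv_scale f k x a : has_deriv f (k * x) a ->
  has_deriv (fun y => f (k * y)) x (k * a).
Proof.
move=> fa; rewrite mulrC; apply: (deriv_comp f (fun y => k * y) x a k fa).
by apply: deriv_eq; [exact: derivZ (deriv_id x) | rewrite mulr1].
Qed.

Lemma derivV f x a : f x != 0 -> has_deriv f x a ->
  has_deriv (fun y => (f y)^-1) x (- (f x) ^- 2 * a).
Proof. by move=> f0 fa; exact: is_deriveV. Qed.

Lemma deriv_ln f x a : 0 < f x -> has_deriv f x a ->
  has_deriv (fun y => ln (f y)) x ((f x)^-1 * a).
Proof. by move=> f0 fa; apply: deriv_comp => //; exact: is_derive1_ln. Qed.

Lemma deriv_exp x : has_deriv (@expR R) x (expR x).
Proof. exact: is_derive_expR. Qed.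

Lemma deriv_le f df a b : a <= b ->
  (forall x, a <= x <= b -> has_deriv f x (df x)) ->
  (forall x, a < x < b -> 0 <= df x) -> f a <= f b.
Proof.
rewrite le_eqVlt => /predU1P[-> //|ab] fd df0.
have cf : {within `[a, b], continuous f}.
  apply: derivable_within_continuous => x; rewrite in_itv/= => xab.
  exact: (@ex_derive _ _ _ _ _ _ _ (fd x xab)).
have [|x + E] := @MVT R f df a b ab _ cf.
  by move=> x; rewrite in_itv/= => /andP[ax xb]; apply: fd; rewrite !ltW.
rewrite in_itv/= => xab; rewrite -subr_ge0 E mulr_ge0 ?df0//.
by rewrite subr_ge0 ltW.
Qed.

Lemma deriv_nondecr f a b : a <= b ->
  (forall x, a <= x <= b -> exists2 d, has_deriv f x d & 0 <= d) -> f a <= f b.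
Proof.
move=> ab fd; apply: (deriv_le f (fun x => 'D_1 f x) a b ab) => x.
  move=> /fd[d fx _]; apply: (deriv_eq _ _ _ _ fx).
  by rewrite (@derive_val _ _ _ _ _ _ _ fx).
move=> /andP[ax xb]; have [|d fx d0] := fd x; first by rewrite !ltW.
by rewrite (@derive_val _ _ _ _ _ _ _ fx).
Qed.

(** The value at the left end enters only through a linear lower bound, so that
    functions given by formulas that are singular at 0 can be handled. *)
Lemma ge0_of_deriv f df C b : 0 < b ->
  (forall x, 0 < x <= b -> has_deriv f x (df x)) ->
  (forall x, 0 < x < b -> 0 <= df x) ->
  (forall x, 0 < x <= b -> - (C * x) <= f x) -> 0 <= f b.
Proof.
move=> b0 fd df0 fC; rewrite leNgt; apply/negP => fb.
pose C' := `|C| + 1.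
have C'0 : 0 < C' by rewrite ltr_wpDl.
pose e := Num.min b (- f b / (2 * C')).
have e0 : 0 < e.
  by rewrite lt_min b0 /= divr_gt0 ?oppr_gt0// mulr_gt0.
have eb : e <= b by rewrite ge_min lexx.
have : f e <= f b.
  apply: (deriv_le f df e b eb) => x /andP[ex xb].
    by apply: fd; rewrite xb (lt_le_trans e0).
  by apply: df0; rewrite xb (lt_trans e0).
have : - (C * e) <= f e by apply: fC; rewrite e0.
have h1 : C * e <= C' * e.
  by rewrite ler_pM2r// (le_trans (ler_norm _))// lerDl.
have h2 : C' * e <= - f b / 2.
  have : e <= - f b / (2 * C') by rewrite ge_min lexx orbT.
  rewrite -(ler_pM2l C'0) => /le_trans; apply.
  by rewrite invfM mulrCA (mulrA C') (mulrC C') -mulrA mulfV ?gt_eqF// mulr1.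
by move=> h3 h4; lra.
Qed.

Lemma deriv_expN x : has_deriv (fun y : R => expR (- y)) x (- expR (- x)).
Proof.
apply: deriv_eq.
  apply: (deriv_comp expR (fun y => - y)); first exact: deriv_exp.
  exact: is_deriveNid.
by rewrite mulrN1.
Qed.

Lemma deriv_sinh x : has_deriv sinh x (cosh x).
Proof.
have -> : @sinh R = fun y : R => (expR y - expR (- y)) / 2.
  by apply/funext => y; rewrite unlock.
apply: deriv_eq.
  apply: (derivM _ _ _ _ _ (derivB _ _ _ _ _ (deriv_exp x) (deriv_expN x))).
  exact: deriv_cst.
by rewrite unlock; ring.
Qed.

Lemma deriv_cosh x : has_deriv cosh x (sinh x).
Proof.
have -> : @cosh R = fun y : R => (expR y + expR (- y)) / 2.
  by apply/funext => y; rewrite unlock.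
apply: deriv_eq.
  apply: (derivM _ _ _ _ _ (derivD _ _ _ _ _ (deriv_exp x) (deriv_expN x))).
  exact: deriv_cst.
by rewrite unlock; ring.
Qed.

Lemma sinh0 : sinh (0 : R) = 0. Proof. by rewrite unlock oppr0 subrr mul0r. Qed.
Lemma cosh0 : cosh (0 : R) = 1.
Proof. by rewrite unlock oppr0 expR0; field. Qed.

Lemma sinh_gt0 x : 0 < x -> 0 < sinh x.
Proof. by move=> x0; rewrite unlock divr_gt0// subr_gt0 ltr_expR; lra. Qed.

Lemma sinh_ge0 x : 0 <= x -> 0 <= sinh x.
Proof. by rewrite le_eqVlt => /predU1P[<-|/sinh_gt0/ltW//]; rewrite sinh0. Qed.

Lemma cosh_gt0 x : 0 < cosh x.
Proof. by rewrite unlock divr_gt0// addr_gt0 ?expR_gt0. Qed.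

Lemma cosh2_sinh2 x : cosh x ^+ 2 - sinh x ^+ 2 = 1.
Proof.
have E : expR x * expR (- x) = 1 by exact: expRxMexpNx_1.
rewrite !unlock.
have -> : ((expR x + expR (- x)) / 2) ^+ 2 - ((expR x - expR (- x)) / 2) ^+ 2 =
  expR x * expR (- x) by field.
by [].
Qed.

Lemma ge0_from0 f df x : f 0 = 0 ->
  (forall x, has_deriv f x (df x)) -> (forall x, 0 <= x -> 0 <= df x) ->
  0 <= x -> 0 <= f x.
Proof.
move=> f0 fd df0 x0; rewrite -f0; apply: (deriv_le f df) => // y /andP[y0 _].
by apply: df0; exact: ltW.
Qed.

End Derivatives.

Ltac deriv := repeat first
  [ exact: deriv_sinh | exact: deriv_cosh | exact: deriv_cst | exact: deriv_id
  | apply: derivB | apply: derivD | apply: derivM | apply: derivX ].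

Section Hyperbolic.
Context {R : realType}.
Implicit Types x : R.

(** The functions [W_0 = sinh] and [W_1], ..., [W_4] of this and the next three
    lemmas satisfy [W_(n+1)' = x W_n] and vanish at 0, whence their signs by
    induction. They are [x ^ (n + 1 / 2)] times modified Bessel functions of order
    [n + 1 / 2], up to a constant; [W_3] and [W_4] bound the Langevin function by
    consecutive convergents of its continued fraction. *)
Lemma bessel1_ge0 x : 0 <= x -> 0 <= x * cosh x - sinh x.
Proof.
apply: (ge0_from0 (fun x => x * cosh x - sinh x) (fun x => x * sinh x)).
- by rewrite sinh0 mul0r subrr.
- by move=> y; apply: deriv_eq; [deriv | rewrite /=; ring].
- by move=> y y0; rewrite mulr_ge0// sinh_ge0.
Qed.

Lemma bessel2_ge0 x : 0 <= x -> 0 <= (x ^+ 2 + 3) * sinh x - 3 * (x * cosh x).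
Proof.
apply: (ge0_from0 (fun x => (x ^+ 2 + 3) * sinh x - 3 * (x * cosh x))
  (fun x => x * (x * cosh x - sinh x))).
- by rewrite sinh0; ring.
- by move=> y; apply: deriv_eq; [deriv | rewrite /=; ring].
- by move=> y y0; rewrite mulr_ge0// bessel1_ge0.
Qed.

Lemma bessel3_ge0 x : 0 <= x ->
  0 <= (x ^+ 3 + 15 * x) * cosh x - (6 * x ^+ 2 + 15) * sinh x.
Proof.
apply: (ge0_from0
  (fun x => (x ^+ 3 + 15 * x) * cosh x - (6 * x ^+ 2 + 15) * sinh x)
  (fun x => x * ((x ^+ 2 + 3) * sinh x - 3 * (x * cosh x)))).
- by rewrite sinh0; ring.
- by move=> y; apply: deriv_eq; [deriv | rewrite /=; ring].
- by move=> y y0; rewrite mulr_ge0// bessel2_ge0.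
Qed.

Lemma bessel4_ge0 x : 0 <= x ->
  0 <= (x ^+ 4 + 45 * x ^+ 2 + 105) * sinh x - (10 * x ^+ 3 + 105 * x) * cosh x.
Proof.
apply: (ge0_from0
  (fun x => (x ^+ 4 + 45 * x ^+ 2 + 105) * sinh x
            - (10 * x ^+ 3 + 105 * x) * cosh x)
  (fun x => x * ((x ^+ 3 + 15 * x) * cosh x - (6 * x ^+ 2 + 15) * sinh x))).
- by rewrite sinh0; ring.
- by move=> y; apply: deriv_eq; [deriv | rewrite /=; ring].
- by move=> y y0; rewrite mulr_ge0// bessel3_ge0.
Qed.

Lemma cosh_ge1 x : 0 <= x -> 1 <= cosh x.
Proof.
move=> x0; rewrite -subr_ge0.
apply: (ge0_from0 (fun x => cosh x - 1) (fun x => sinh x)) => //.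
- by rewrite cosh0 subrr.
- by move=> y; apply: deriv_eq; [deriv | rewrite /=; ring].
- by move=> y y0; exact: sinh_ge0.
Qed.

Lemma sinh_ge_id x : 0 <= x -> x <= sinh x.
Proof.
move=> x0; rewrite -subr_ge0.
apply: (ge0_from0 (fun x => sinh x - x) (fun x => cosh x - 1)) => //.
- by rewrite sinh0 subrr.
- by move=> y; apply: deriv_eq; [deriv | rewrite /=; ring].
- by move=> y y0; rewrite subr_ge0 cosh_ge1.
Qed.

Lemma sinh_ge_cubic x : 0 <= x -> x * (1 + x ^+ 2 / 6) <= sinh x.
Proof.
move=> x0; rewrite -subr_ge0.
apply: (ge0_from0 (fun x => sinh x - x * (1 + x ^+ 2 / 6))
  (fun x => cosh x - 1 - x ^+ 2 / 2)) => //.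
- by rewrite sinh0; ring.
- by move=> y; apply: deriv_eq; [deriv | rewrite /=; field].
- move=> y y0.
  apply: (ge0_from0 (fun x => cosh x - 1 - x ^+ 2 / 2) (fun x => sinh x - x)) => //.
  + by rewrite cosh0; ring.
  + by move=> z; apply: deriv_eq; [deriv | rewrite /=; field].
  + by move=> z z0; rewrite subr_ge0 sinh_ge_id.
Qed.

Lemma cosh_le_exp x : 0 <= x -> cosh x <= expR x.
Proof.
move=> x0; rewrite unlock ler_pdivrMr// mulr_natr mulr2n lerD2l ler_expR.
by rewrite (le_trans _ x0)// oppr_le0.
Qed.

End Hyperbolic.

(** * The Langevin function *)

Section Langevin.
Context {R : realType}.
Implicit Types (x y a b p : R).

(** The logarithm of [geomG n (exp (- 2 x))] is affine in [x] up to values of this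
    function, see [ln_geomG]. *)
Definition lsinhc y : R := ln (sinh y / y).
(** The Langevin function, which is the derivative of [lsinhc]. *)
Definition langevin y : R := cosh y / sinh y - y^-1.

Lemma deriv_lsinhc y : 0 < y -> has_deriv lsinhc y (langevin y).
Proof.
move=> y0; have s0 := sinh_gt0 y y0.
apply: deriv_eq.
  apply: deriv_ln; first by rewrite divr_gt0.
  apply: derivM; first exact: deriv_sinh.
  by apply: derivV; [rewrite gt_eqF | exact: deriv_id].
by rewrite /langevin; field; rewrite !gt_eqF.
Qed.

Lemma lsinhc_bounds y : 0 < y -> 0 <= lsinhc y <= y.
Proof.
move=> y0; have s0 := sinh_gt0 y y0; have y1 := ltW y0.
apply/andP; split.
  by apply: ln_ge0; rewrite ler_pdivlMr// mul1r sinh_ge_id.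
have q0 : 0 < sinh y / y by exact: divr_gt0.
rewrite -[leRHS]expRK /lsinhc ler_ln ?posrE ?expR_gt0//.
rewrite ler_pdivrMr// mulrC (@le_trans _ _ (y * cosh y))//.
  by have := bessel1_ge0 y y1; rewrite subr_ge0.
by rewrite ler_pM2l// cosh_le_exp.
Qed.

Lemma langevin0 : langevin 0 = 0.
Proof. by rewrite /langevin sinh0 !invr0 mulr0 subrr. Qed.

Lemma langevin_lower y : 0 <= y -> 5 * y / (15 + y ^+ 2) <= langevin y.
Proof.
rewrite le_eqVlt => /predU1P[<-|y0].
  by rewrite langevin0 mulr0 mul0r.
have s0 := sinh_gt0 y y0; have y2 : 0 < 15 + y ^+ 2 by rewrite ltr_wpDr ?sqr_ge0.
rewrite -subr_ge0 /langevin.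
have -> : cosh y / sinh y - y^-1 - 5 * y / (15 + y ^+ 2) =
  ((y ^+ 3 + 15 * y) * cosh y - (6 * y ^+ 2 + 15) * sinh y)
  / (y * sinh y * (15 + y ^+ 2)).
  by field; rewrite !gt_eqF.
by rewrite divr_ge0 ?bessel3_ge0 ?mulr_ge0 ?(ltW y0) ?(ltW s0) ?(ltW y2).
Qed.

Lemma langevin_upper y : 0 <= y ->
  langevin y <= y * (35 + y ^+ 2) / (105 + 10 * y ^+ 2).
Proof.
rewrite le_eqVlt => /predU1P[<-|y0].
  by rewrite langevin0 !mul0r.
have s0 := sinh_gt0 y y0; have y1 := ltW y0.
have y2 : 0 < 105 + 10 * y ^+ 2 by rewrite ltr_wpDr ?mulr_ge0 ?sqr_ge0.
rewrite -subr_ge0 /langevin.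
have -> : y * (35 + y ^+ 2) / (105 + 10 * y ^+ 2) - (cosh y / sinh y - y^-1) =
  ((y ^+ 4 + 45 * y ^+ 2 + 105) * sinh y - (10 * y ^+ 3 + 105 * y) * cosh y)
  / (y * sinh y * (105 + 10 * y ^+ 2)).
  by field; rewrite !gt_eqF.
by rewrite divr_ge0 ?bessel4_ge0 ?mulr_ge0 ?(ltW y0) ?(ltW s0) ?(ltW y2).
Qed.

Lemma langevin_gt0 y : 0 < y -> 0 < langevin y.
Proof.
move=> y0; apply: lt_le_trans (langevin_lower y (ltW y0)).
by rewrite divr_gt0 ?mulr_gt0// ltr_wpDr ?sqr_ge0.
Qed.

Lemma langevin_le_third y : 0 <= y -> langevin y <= y / 3.
Proof.
move=> y0; apply: le_trans (langevin_upper y y0) _.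
have y2 : 0 < 105 + 10 * y ^+ 2 by rewrite ltr_wpDr ?mulr_ge0 ?sqr_ge0.
rewrite ler_pdivrMr// -subr_ge0.
have -> : y / 3 * (105 + 10 * y ^+ 2) - y * (35 + y ^+ 2) = 7 / 3 * (y * y ^+ 2).
  by field.
by rewrite mulr_ge0// mulr_ge0 ?sqr_ge0.
Qed.

Lemma deriv_langevin y : 0 < y ->
  has_deriv langevin y ((y ^+ 2)^-1 - (sinh y ^+ 2)^-1).
Proof.
move=> y0; have s0 := sinh_gt0 y y0.
apply: deriv_eq.
  apply: derivB.
    apply: derivM; first exact: deriv_cosh.
    by apply: derivV; [rewrite gt_eqF | exact: deriv_sinh].
  by apply: derivV; [rewrite gt_eqF | exact: deriv_id].
rewrite -[X in _ = _ - X]mul1r -[X in X * _^-1](cosh2_sinh2 y).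
by field; rewrite !gt_eqF.
Qed.

(** This form of the derivative lets bounds on [langevin] itself control the
    growth of its quotient by a rational function. *)
Lemma langevin_riccati y : 0 < y ->
  (y ^+ 2)^-1 - (sinh y ^+ 2)^-1 = 1 - langevin y ^+ 2 - 2 * langevin y / y.
Proof.
move=> y0; have s0 := sinh_gt0 y y0.
have -> : (sinh y ^+ 2)^-1 = (cosh y ^+ 2 - sinh y ^+ 2) / sinh y ^+ 2.
  by rewrite cosh2_sinh2 mul1r.
by rewrite /langevin; field; rewrite !gt_eqF.
Qed.

Lemma langevin_nondecr x y : 0 < x -> x <= y -> langevin x <= langevin y.
Proof.
move=> x0 xy.
apply: (deriv_le langevin (fun y => (y ^+ 2)^-1 - (sinh y ^+ 2)^-1)) => //.
  by move=> z /andP[xz _]; apply: deriv_langevin; exact: lt_le_trans xz.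
move=> z /andP[xz _]; have z0 := lt_trans x0 xz.
rewrite subr_ge0 lef_pV2 ?posrE ?exprn_gt0 ?sinh_gt0//.
by rewrite ler_pXn2r ?nnegrE ?sinh_ge0 ?sinh_ge_id// ltW.
Qed.

(** The derivative is [4 sinh y (y cosh y - sinh y)]. *)
Lemma sinh_cosh_ge y : 0 <= y -> 0 <= 2 * y * cosh y ^+ 2 + y - 3 * sinh y * cosh y.
Proof.
apply: (ge0_from0 (fun y => 2 * y * cosh y ^+ 2 + y - 3 * sinh y * cosh y)
  (fun y => 4 * (sinh y * (y * cosh y - sinh y)))).
- by rewrite sinh0; ring.
- move=> z; apply: deriv_eq; first deriv.
  have -> : 4 * (sinh z * (z * cosh z - sinh z)) =
    4 * (sinh z * (z * cosh z - sinh z)) - (cosh z ^+ 2 - sinh z ^+ 2) + 1.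
    by rewrite cosh2_sinh2; ring.
  by rewrite /=; ring.
- by move=> z z0; rewrite mulr_ge0// mulr_ge0 ?sinh_ge0 ?bessel1_ge0.
Qed.

(** Up to sign and a positive denominator, this is the derivative of
    [langevin y / y]. *)
Lemma langevin_div_ge y : 0 <= y ->
  0 <= y * sinh y * cosh y + y ^+ 2 - 2 * sinh y ^+ 2.
Proof.
apply: (ge0_from0 (fun y => y * sinh y * cosh y + y ^+ 2 - 2 * sinh y ^+ 2)
  (fun y => 2 * y * cosh y ^+ 2 + y - 3 * sinh y * cosh y)).
- by rewrite sinh0; ring.
- move=> z; apply: deriv_eq; first deriv.
  have -> : 2 * z * cosh z ^+ 2 + z - 3 * sinh z * cosh z =
    z * (cosh z ^+ 2 + sinh z ^+ 2) + z * (cosh z ^+ 2 - sinh z ^+ 2) + z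
    - 3 * sinh z * cosh z by ring.
  by rewrite cosh2_sinh2/=; ring.
- by move=> z; exact: sinh_cosh_ge.
Qed.

(** In other words [langevin y / y] is nonincreasing, by [langevin_div_ge]. *)
Lemma langevin_sublinear x y : 0 < x -> x <= y -> x * langevin y <= y * langevin x.
Proof.
move=> x0 xy; have y0 := lt_le_trans x0 xy.
have : - (langevin x / x) <= - (langevin y / y).
  have E z : 0 < z -> has_deriv (fun z => 0 - langevin z / z) z
      ((z * sinh z * cosh z + z ^+ 2 - 2 * sinh z ^+ 2) / (z ^+ 3 * sinh z ^+ 2)).
    move=> z0; have s0 := sinh_gt0 z z0.
    apply: deriv_eq.
      apply: derivB; first exact: deriv_cst.
      apply: derivM; first exact: deriv_langevin.
      by apply: derivV; [rewrite gt_eqF | exact: deriv_id].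
    by rewrite /langevin; field; rewrite !gt_eqF.
  rewrite -[X in X <= _]sub0r -[X in _ <= X]sub0r.
  apply: (deriv_nondecr (fun z => 0 - langevin z / z) _ _ xy) => z /andP[xz _].
  have z0 := lt_le_trans x0 xz; eexists; first exact: E.
  by rewrite divr_ge0 ?langevin_div_ge ?mulr_ge0 ?exprn_ge0 ?sinh_ge0 ?ltW.
by rewrite lerN2 ler_pdivrMr// mulrAC ler_pdivlMr// (mulrC _ x) (mulrC _ y).
Qed.

(** The logarithm of the quotient of the two sides has derivative
    [3 langevin y - tanh y], nonnegative by [sinh_cosh_ge]. The inequality is the
    concavity of [langevin]. *)
Lemma sinh_cube_ge y : 0 < y -> y ^+ 3 * cosh y <= sinh y ^+ 3.
Proof.
move=> y0; have s0 := sinh_gt0 y y0; have c0 := cosh_gt0 y.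
have : 0 <= 3 * lsinhc y - ln (cosh y).
  apply: (ge0_of_deriv (fun y => 3 * lsinhc y - ln (cosh y))
    (fun y => 3 * langevin y - (cosh y)^-1 * sinh y) 1 _ y0).
  - move=> z /andP[z0 _]; apply: derivB; first exact/derivZ/deriv_lsinhc.
    by apply: deriv_ln; [exact: cosh_gt0 | exact: deriv_cosh].
  - move=> z /andP[z0 _]; have sz := sinh_gt0 z z0; have cz := cosh_gt0 z.
    have -> : 3 * langevin z - (cosh z)^-1 * sinh z =
      (2 * z * cosh z ^+ 2 + z * (cosh z ^+ 2 - sinh z ^+ 2)
       - 3 * sinh z * cosh z) / (z * sinh z * cosh z).
      by rewrite /langevin; field; rewrite !gt_eqF.
    rewrite cosh2_sinh2 mulr1 divr_ge0 ?sinh_cosh_ge ?(ltW z0)//.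
    by rewrite ltW// !mulr_gt0.
  - move=> z /andP[z0 _]; have /andP[Sz _] := lsinhc_bounds z z0.
    have : ln (cosh z) <= z.
      rewrite -[leRHS]expRK ler_ln ?posrE ?expR_gt0 ?cosh_gt0//.
      by rewrite cosh_le_exp ?ltW.
    by rewrite mul1r; lra.
have -> : 3 * lsinhc y = ln ((sinh y / y) ^+ 3).
  by rewrite lnXn ?divr_gt0// mulr_natl.
rewrite subr_ge0 ler_ln ?posrE ?exprn_gt0 ?divr_gt0//.
by rewrite expr_div_n ler_pdivlMr ?exprn_gt0// mulrC.
Qed.

Lemma deriv_langevin_antitone x y : 0 < x -> x <= y ->
  (y ^+ 2)^-1 - (sinh y ^+ 2)^-1 <= (x ^+ 2)^-1 - (sinh x ^+ 2)^-1.
Proof.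
move=> x0 xy; rewrite -lerN2 !opprB.
have E z : 0 < z -> has_deriv (fun z => (sinh z ^+ 2)^-1 - (z ^+ 2)^-1) z
   (2 * (sinh z ^+ 3 - z ^+ 3 * cosh z) / (z ^+ 3 * sinh z ^+ 3)).
  move=> z0; have s0 := sinh_gt0 z z0.
  apply: deriv_eq.
    apply: derivB.
      apply: derivV; first by rewrite expf_neq0// gt_eqF.
      by apply: derivX; exact: deriv_sinh.
    apply: derivV; first by rewrite expf_neq0// gt_eqF.
    by apply: derivX; exact: deriv_id.
  by rewrite /=; field; rewrite !gt_eqF.
apply: (deriv_nondecr (fun z => (sinh z ^+ 2)^-1 - (z ^+ 2)^-1) _ _ xy) => z /andP[xz _].
have z0 := lt_le_trans x0 xz; eexists; first exact: E.
have s0 := sinh_gt0 z z0.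
by rewrite divr_ge0 ?mulr_ge0 ?exprn_ge0 ?subr_ge0 ?sinh_cube_ge// ltW.
Qed.

Lemma langevin_tangent x y : 0 < x -> 0 < y ->
  langevin y <= langevin x + ((x ^+ 2)^-1 - (sinh x ^+ 2)^-1) * (y - x).
Proof.
move=> x0 y0; set d := _ - _.
pose g z := d * (z - x) - langevin z.
have E z : 0 < z -> has_deriv g z (d - ((z ^+ 2)^-1 - (sinh z ^+ 2)^-1)).
  move=> z0; apply: deriv_eq.
    apply: derivB; last exact: deriv_langevin.
    by apply: derivZ; apply: derivB; [exact: deriv_id | exact: deriv_cst].
  by ring.
have gx : g x = - langevin x by rewrite /g subrr mulr0 sub0r.
suff : g x <= g y by rewrite gx /g; lra.
(* the derivative of [g] has the sign of [z - x] *)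
have [xy|yx] := leP x y.
  apply: (deriv_nondecr g _ _ xy) => z /andP[xz _].
  have z0 := lt_le_trans x0 xz; eexists; first exact: E.
  by rewrite subr_ge0; exact: deriv_langevin_antitone.
rewrite -lerN2 -[X in X <= _]sub0r -[X in _ <= X]sub0r.
apply: (deriv_le (fun z => 0 - g z)
   (fun z => 0 - (d - ((z ^+ 2)^-1 - (sinh z ^+ 2)^-1))) y x (ltW yx)).
  move=> z /andP[h _]; apply: derivB; first exact: deriv_cst.
  by apply: E; exact: lt_le_trans h.
move=> z /andP[yz zx]; rewrite sub0r opprB subr_ge0.
by apply: deriv_langevin_antitone; rewrite ?(ltW zx)// (lt_trans y0).
Qed.

Lemma langevin_concave p x y : 0 <= p <= 1 -> 0 < x -> 0 < y ->
  (1 - p) * langevin x + p * langevin y <= langevin ((1 - p) * x + p * y).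
Proof.
move=> /andP[p0 p1] x0 y0; set z := _ * x + _.
have z0 : 0 < z.
  move: (p0); rewrite /z le_eqVlt => /predU1P[<-|p0'].
    by rewrite subr0 mul1r mul0r addr0.
  by rewrite ltr_wpDl ?mulr_gt0// mulr_ge0 ?subr_ge0// ltW.
have hx := langevin_tangent z x z0 x0; have hy := langevin_tangent z y z0 y0.
set d := _ - (sinh z ^+ 2)^-1 in hx hy.
have p1' : 0 <= 1 - p by rewrite subr_ge0.
have E : (1 - p) * (d * (x - z)) + p * (d * (y - z)) = 0 by rewrite /z; ring.
have {}hx := ler_wpM2l p1' hx; have {}hy := ler_wpM2l p0 hy.
clearbody z d; move: hx hy E.
set X := langevin x; set Y := langevin y; set Z := langevin z => hx hy E.
have -> : Z = (1 - p) * (Z + d * (x - z)) + p * (Z + d * (y - z)).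
  have -> : (1 - p) * (Z + d * (x - z)) + p * (Z + d * (y - z)) =
    Z + ((1 - p) * (d * (x - z)) + p * (d * (y - z))) by ring.
  by rewrite E addr0.
exact: lerD.
Qed.

(** The quotient of [langevin] by its approximant [5 y / (15 + y ^ 2)]. *)
Definition pade_ratio y := langevin y * (15 + y ^+ 2) / (5 * y).

(** By the Riccati equation the sign of the derivative is that of a decreasing
    function of [langevin], hence it is enough to replace [langevin] by its upper
    bound, the next convergent. *)
Lemma pade_ratio_nondecr x y : 0 < x -> x <= y -> y ^+ 2 <= 10 ->
  pade_ratio x <= pade_ratio y.
Proof.
move=> x0 xy y10.
have E z : 0 < z -> has_deriv pade_ratio z
    (((15 + z ^+ 2) * (z - z * langevin z ^+ 2) - (45 + z ^+ 2) * langevin z)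
     / (5 * z ^+ 2)).
  move=> z0; have s0 := sinh_gt0 z z0.
  have hL := deriv_langevin z z0; rewrite langevin_riccati// in hL.
  apply: deriv_eq.
    apply: derivM.
      apply: derivM; first exact: hL.
      by apply: derivD; [exact: deriv_cst | apply: derivX; exact: deriv_id].
    apply: derivV; first by rewrite mulf_neq0// gt_eqF.
    by apply: derivZ; exact: deriv_id.
  by rewrite /=; field; rewrite !gt_eqF.
apply: (deriv_nondecr pade_ratio _ _ xy) => z /andP[xz zy].
have z0 := lt_le_trans x0 xz; eexists; first exact: E.
rewrite divr_ge0 ?mulr_ge0 ?(ltW z0)//.
have Z10 : z ^+ 2 <= 10.
  by apply: le_trans y10; rewrite ler_pXn2r ?nnegrE ?(ltW z0)// (le_trans (ltW z0)).
have L0 := langevin_gt0 z z0; have LU := langevin_upper z (ltW z0).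
set l := langevin z in L0 LU *.
have D0 : 0 < 105 + 10 * z ^+ 2 by rewrite ltr_wpDr ?mulr_ge0 ?(ltW z0).
set U := _ / _ in LU.
have l2 : l ^+ 2 <= U ^+ 2 by rewrite ler_pXn2r ?nnegrE ?(ltW L0)// (le_trans (ltW L0)).
have Z0 : 0 <= z ^+ 2 by exact: sqr_ge0.
apply: (@le_trans _ _
  ((15 + z ^+ 2) * (z - z * U ^+ 2) - (45 + z ^+ 2) * U)).
  have -> : (15 + z ^+ 2) * (z - z * U ^+ 2) - (45 + z ^+ 2) * U =
    z * (420 * z ^+ 2 ^+ 2 + 5 * z ^+ 2 ^+ 3 - z ^+ 2 ^+ 4)
    / (105 + 10 * z ^+ 2) ^+ 2.
    by rewrite /U; field; rewrite gt_eqF.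
  apply: divr_ge0; last exact: sqr_ge0.
  apply: mulr_ge0; first exact: ltW.
  set Z := z ^+ 2 in Z0 Z10 *.
  have -> : 420 * Z ^+ 2 + 5 * Z ^+ 3 - Z ^+ 4 =
    Z ^+ 2 * (420 + 5 * Z - Z * Z) by ring.
  apply: mulr_ge0; first exact: sqr_ge0.
  have : Z * Z <= 10 * Z by rewrite ler_wpM2r.
  by lra.
rewrite lerB//.
  rewrite ler_wpM2l//; first by rewrite addr_ge0.
  by rewrite lerB// ler_wpM2l// ltW.
by rewrite ler_wpM2l// addr_ge0.
Qed.

Lemma pade_ratio_bounds y : 0 < y ->
  1 <= pade_ratio y <= 1 + y ^+ 2 ^+ 2 / (525 + 50 * y ^+ 2).
Proof.
move=> y0; rewrite /pade_ratio.
have y2 := sqr_ge0 y; have D0 : 0 < 15 + y ^+ 2 by rewrite ltr_wpDr.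
have D1 : 0 < 105 + 10 * y ^+ 2 by rewrite ltr_wpDr ?mulr_ge0 ?(ltW y0).
have L1 := langevin_lower y (ltW y0); have L2 := langevin_upper y (ltW y0).
apply/andP; split.
  rewrite ler_pdivlMr ?mulr_gt0// mul1r.
  by move: L1; rewrite ler_pdivrMr.
rewrite ler_pdivrMr ?mulr_gt0//.
apply: (@le_trans _ _ (y * (35 + y ^+ 2) / (105 + 10 * y ^+ 2) * (15 + y ^+ 2))).
  by rewrite ler_pM2r.
rewrite le_eqVlt; apply/orP; left; apply/eqP; field.
have D2 : 0 < 525 + 50 * y ^+ 2.
  have -> : 525 + 50 * y ^+ 2 = 5 * (105 + 10 * y ^+ 2) by ring.
  exact: mulr_gt0.
by rewrite (gt_eqF D1) (gt_eqF D2).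
Qed.

Lemma langevin_pade y : 0 < y -> langevin y = pade_ratio y * (5 * y / (15 + y ^+ 2)).
Proof.
move=> y0; rewrite /pade_ratio; field.
by rewrite !gt_eqF//= ltr_wpDr ?sqr_ge0.
Qed.

End Langevin.

(** * Admissibility at a fixed argument *)

Section Reduction.
Context {R : realType}.
Implicit Types (x y t p a b w : R) (r s n : nat).

Lemma ln_le_subr1 x : 0 < x -> ln x <= x - 1.
Proof.
move=> x0; rewrite [X in ln X](_ : x = 1 + (x - 1)); last by ring.
by apply: le_ln1Dx; lra.
Qed.

(** Concavity of the logarithm between 1 and [w], with weights [1 - p] and [p]. *)
Lemma ln_bernoulli p w : 0 <= p <= 1 -> 0 < w -> p * ln w <= ln (1 + p * (w - 1)).
Proof.
move=> /andP[p0 p1] w0; set z := 1 + _.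
have z0 : 0 < z.
  have -> : z = (1 - p) + p * w by rewrite /z; ring.
  move: p0; rewrite le_eqVlt => /predU1P[<-|p0]; first by rewrite mul0r subr0 addr0.
  by rewrite ltr_wpDl ?mulr_gt0// subr_ge0.
have h1 : ln w - ln z <= w / z - 1.
  by rewrite -ln_div ?posrE// ln_le_subr1 ?divr_gt0.
have h2 : - ln z <= z^-1 - 1.
  by rewrite -lnV ?posrE// ln_le_subr1 ?invr_gt0.
have {}h1 := ler_wpM2l p0 h1.
have p1' : 0 <= 1 - p by rewrite subr_ge0.
have {}h2 := ler_wpM2l p1' h2.
have : p * (w / z - 1) + (1 - p) * (z^-1 - 1) = 0.
  by rewrite /z; field; move: z0; rewrite lt0r => /andP[].
by move: h1 h2; rewrite !mulrBr !mulrBl !mul1r; lra.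
Qed.

Lemma powR_bernoulli p w : 0 <= p <= 1 -> 0 < w -> w `^ p <= 1 + p * (w - 1).
Proof.
move=> p01 w0.
have z0 : 0 < 1 + p * (w - 1).
  case/andP: p01 => p0 p1; have -> : 1 + p * (w - 1) = (1 - p) + p * w by ring.
  move: p0; rewrite le_eqVlt => /predU1P[<-|p0]; first by rewrite mul0r subr0 addr0.
  by rewrite ltr_wpDl ?mulr_gt0// subr_ge0.
by rewrite -ler_ln ?posrE ?powR_gt0// ln_powR ln_bernoulli.
Qed.

Lemma powR_subr1 x p : 0 < x -> x `^ (1 - p) = x / x `^ p.
Proof.
by move=> x0; rewrite powRB ?(gt_eqF x0) ?implybT// powRr1 ?ltW.
Qed.

Lemma powR_subl1 x p : 0 < x -> x `^ (p - 1) = x `^ p / x.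
Proof.
by move=> x0; rewrite powRB ?(gt_eqF x0) ?implybT// powRr1 ?ltW.
Qed.

Lemma powR_inv x p : 0 < x -> x^-1 `^ p = (x `^ p)^-1.
Proof.
by move=> x0; rewrite -powR_inv1 ?(ltW x0)// powRAC powR_inv1 ?powR_ge0.
Qed.

Lemma weighted_amgm p x y : 0 <= p <= 1 -> 0 < x -> 0 < y ->
  x `^ (1 - p) * y `^ p <= (1 - p) * x + p * y.
Proof.
move=> p01 x0 y0.
have -> : x `^ (1 - p) * y `^ p = x * (y / x) `^ p.
  rewrite powRM ?invr_ge0 ?(ltW x0) ?(ltW y0)// powR_subr1// powR_inv//.
  by ring.
apply: le_trans (ler_wpM2l (ltW x0) (powR_bernoulli p _ p01 (divr_gt0 y0 x0))) _.
by rewrite le_eqVlt; apply/orP; left; apply/eqP; field; rewrite gt_eqF.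
Qed.

Lemma geomGE n t : (1 - t) * geomG n t = 1 - t ^+ n.+1.
Proof.
rewrite /geomG -[in RHS](expr1n _ n.+1) subrXX; congr (_ * _).
by apply: eq_bigr => i _; rewrite expr1n mul1r.
Qed.

Lemma powR_expR p x : expR x `^ p = expR (p * x).
Proof. by rewrite -expRM mulrC. Qed.

Lemma powR_natX t p n : 0 <= t -> (t `^ p) ^+ n = (t ^+ n) `^ p.
Proof. by move=> t0; rewrite -!powR_mulrn ?powR_ge0// powRAC. Qed.

Lemma powR_lt1 t p : 0 < t < 1 -> 0 < p -> t `^ p < 1.
Proof.
move=> /andP[t0 t1] p0; rewrite -ltr_ln ?posrE ?powR_gt0// ln1 ln_powR.
by rewrite pmulr_rlt0// ln_lt0// t0.
Qed.

(** For fixed [t], admissibility at [t] for all [s] is a single concave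
    inequality in the variable [b = t ^+ s.+1]. *)
Lemma admissible_atE r s t p : 0 < t < 1 -> 0 < p ->
  (geomG r t `^ p * geomG s t `^ p <= geomG (r + s) (t `^ p)) =
  ((1 - t `^ p) * (geomG r t / (1 - t)) `^ p * (1 - t ^+ s.+1) `^ p
   + t `^ (p * r%:R) * (t ^+ s.+1) `^ p <= 1).
Proof.
move=> /andP[t0 t1] p0; have u1 : t `^ p < 1 by rewrite powR_lt1// t0.
have v0 : 0 < 1 - t by rewrite subr_gt0.
have -> : geomG r t `^ p * geomG s t `^ p =
    (geomG r t / (1 - t)) `^ p * (1 - t ^+ s.+1) `^ p.
  have g0 := @geomG_gt0 R r t (ltW t0); have gs := @geomG_gt0 R s t (ltW t0).
  rewrite -geomGE -!powRM ?mulr_ge0 ?invr_ge0 ?(ltW v0) ?(ltW g0) ?(ltW gs)//.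
  by congr (_ `^ _); field; rewrite gt_eqF.
have w0 : 0 < 1 - t `^ p by rewrite subr_gt0.
rewrite -(ler_pM2l w0) geomGE mulrA lerBrDr.
have -> // : (t `^ p) ^+ (r + s).+1 = t `^ (p * r%:R) * (t ^+ s.+1) `^ p.
rewrite -addnS exprD powRrM powR_mulrn ?powR_ge0//.
by rewrite (powR_natX t p s.+1) ?ltW.
Qed.

(** With [b = t ^ (s + 1)] and [v = p r / (1 - p) >= r + 1], the weighted
    arithmetic-geometric inequalities for the pairs [(1 - t ^ (r + 1), 1 - b)] and
    [(t ^ v, b)] add up to at most 1; the last hypothesis compares the first
    coefficient with [(1 - t ^ (r + 1)) ^ (1 - p)]. *)
Lemma admissible_at_small r s t p : 0 < t < 1 -> 0 < p < 1 ->
  (1 - p) * (r + 1)%:R <= p * r%:R ->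
  (1 - t `^ p) * geomG r t `^ (2 * p - 1) <= 1 - t ->
  geomG r t `^ p * geomG s t `^ p <= geomG (r + s) (t `^ p).
Proof.
move=> t01 /andP[p0 p1] pv ht; rewrite (admissible_atE r s t p t01 p0).
case/andP: (t01) => t0 t1.
have v0 : 0 < 1 - t by rewrite subr_gt0.
have g0 := @geomG_gt0 R r t (ltW t0).
have q0 : 0 < 1 - p by rewrite subr_gt0.
have b0 n : 0 < t ^+ n by rewrite exprn_gt0.
have b1 n : 0 < 1 - t ^+ n.+1 by rewrite subr_gt0 exprn_ilt1// ltW.
have p01 : 0 <= p <= 1 by rewrite !ltW.
have h1 : (1 - t `^ p) * (geomG r t / (1 - t)) `^ p <= (1 - t ^+ r.+1) `^ (1 - p).
  rewrite -geomGE !powRM ?invr_ge0 ?(ltW v0) ?(ltW g0)//.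
  have -> : geomG r t `^ p = geomG r t `^ (2 * p - 1) * geomG r t `^ (1 - p).
    by rewrite -powRD ?(gt_eqF g0) ?implybT//; congr (_ `^ _); ring.
  have -> : (1 - t)^-1 `^ p = (1 - t) `^ (1 - p) / (1 - t).
    by rewrite powR_subr1// powR_inv//; field; rewrite !gt_eqF ?powR_gt0.
  set G := geomG r t `^ (1 - p); set V := (1 - t) `^ (1 - p).
  have -> : (1 - t `^ p) * (geomG r t `^ (2 * p - 1) * G * (V / (1 - t))) =
    (1 - t `^ p) * geomG r t `^ (2 * p - 1) * (G * V / (1 - t)) by ring.
  have -> : V * G = (1 - t) * (G * V / (1 - t)) by field; rewrite gt_eqF.
  by rewrite ler_pM2r// !mulr_gt0 ?invr_gt0 ?powR_gt0.
have b1s := b1 s; have b0s := b0 s.+1.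
have := ler_wpM2r (powR_ge0 (1 - t ^+ s.+1) p) h1 => /le_trans.
have h2 := weighted_amgm p _ _ p01 (b1 r) b1s.
have e0 : 0 < t `^ (p * r%:R / (1 - p)) by rewrite powR_gt0.
have h3 := weighted_amgm p _ _ p01 e0 b0s.
have E3 : (t `^ (p * r%:R / (1 - p))) `^ (1 - p) = t `^ (p * r%:R).
  by rewrite -powRrM divfK// gt_eqF.
rewrite E3 in h3.
(* the hypothesis says that the exponent [v = p r / (1 - p)] is at least [r + 1] *)
have h4 : t `^ (p * r%:R / (1 - p)) <= t ^+ r.+1.
  rewrite -powR_mulrn ?(ltW t0)//; apply: ger_powR; first by rewrite t0 ltW.
  by rewrite ler_pdivlMr// mulrC -(addn1 r).
have {}h4 := ler_wpM2l (ltW q0) h4.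
move=> /(_ _ h2) h5; apply: le_trans (lerD h5 h3) _.
by move: h4; rewrite !mulrBr !mulr1; lra.
Qed.

(** Tangent-line step: once the concave function of [b = t ^+ s.+1] is past its
    maximum at [s], admissibility at [t] propagates to every larger [s]. *)
Lemma admissible_at_mono r s s' t p : 0 < t < 1 -> 0 < p < 1 -> (s <= s')%N ->
  (1 - t `^ p) * (geomG r t / (1 - t)) `^ p * (1 - t ^+ s.+1) `^ (p - 1)
    <= t `^ (p * r%:R) * (t ^+ s.+1) `^ (p - 1) ->
  geomG r t `^ p * geomG s t `^ p <= geomG (r + s) (t `^ p) ->
  geomG r t `^ p * geomG s' t `^ p <= geomG (r + s') (t `^ p).
Proof.
move=> t01 /andP[p0 p1] ss' slope; rewrite !admissible_atE//.
case/andP: (t01) => t0 t1.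
have b0 n : 0 < t ^+ n by rewrite exprn_gt0.
have c0 n : 0 < 1 - t ^+ n.+1 by rewrite subr_gt0 exprn_ilt1// ltW.
have bb' : t ^+ s'.+1 <= t ^+ s.+1 by rewrite ler_wiXn2l// ltW.
have := b0 s.+1; have := b0 s'.+1; have := c0 s; have := c0 s'; move: bb' slope.
set b := t ^+ s.+1; set b' := t ^+ s'.+1; set T := t `^ (p * r%:R).
set A := (1 - t `^ p) * _ => bb' slope c'0 cs0 b'0 bs0 le1.
have A0 : 0 <= A by rewrite mulr_ge0 ?powR_ge0 ?subr_ge0 ?ltW ?powR_lt1.
have T0 : 0 <= T by exact: powR_ge0.
have p01 : 0 <= p <= 1 by rewrite !ltW.
have step x y : 0 < x -> 0 < y -> y `^ p <= x `^ p + p * (y - x) * x `^ (p - 1).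
  move=> x0 y0; have xp := powR_gt0 p x0.
  have -> : y `^ p = x `^ p * (y / x) `^ p.
    rewrite -powRM ?(ltW x0) ?divr_ge0 ?ltW//; congr (_ `^ _); field.
    by rewrite gt_eqF.
  apply: le_trans (ler_wpM2l (ltW xp) (powR_bernoulli p _ p01 (divr_gt0 y0 x0))) _.
  rewrite powR_subl1// le_eqVlt.
  by apply/orP; left; apply/eqP; field; rewrite gt_eqF.
have h1 := ler_wpM2l A0 (step _ _ cs0 c'0).
have h2 := ler_wpM2l T0 (step _ _ bs0 b'0).
apply: le_trans (lerD h1 h2) _; apply: le_trans le1.
have h3 : 0 <= p * (b - b') by rewrite mulr_ge0 ?(ltW p0)// subr_ge0.
have := ler_wpM2l h3 slope.
set B := (1 - b) `^ (p - 1); set C := b `^ (p - 1) => h4.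
rewrite -subr_ge0.
have -> : A * (1 - b) `^ p + T * b `^ p -
    (A * ((1 - b) `^ p + p * (1 - b' - (1 - b)) * B) +
     T * (b `^ p + p * (b' - b) * C)) =
  p * (b - b') * (T * C) - p * (b - b') * (A * B) by ring.
by rewrite subr_ge0.
Qed.

End Reduction.

(** * Admissibility through logarithmic derivatives *)

Section NearOne.
Context {R : realType}.
Implicit Types (x y t p a b w : R) (r s n : nat).

Lemma one_sub_expE y : 1 - expR (- (2 * y)) = 2 * expR (- y) * sinh y.
Proof.
have -> : expR (- (2 * y)) = expR (- y) * expR (- y).
  by rewrite -expRD; congr expR; ring.
have E : expR y * expR (- y) = 1 by rewrite -expRD subrr expR0.
by rewrite -[X in X - _]E unlock; field.
Qed.

Lemma ln_one_sub_exp y : 0 < y ->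
  ln (1 - expR (- (2 * y))) = ln 2 - y + ln y + lsinhc y.
Proof.
move=> y0; have s0 := sinh_gt0 y y0.
have q0 : 0 < sinh y / y by exact: divr_gt0.
have e0 := expR_gt0 (- y).
rewrite one_sub_expE /lsinhc ln_div ?posrE// !lnM ?posrE ?mulr_gt0// expRK.
by ring.
Qed.

Lemma expRX x n : expR (- (2 * x)) ^+ n = expR (- (2 * (n%:R * x))).
Proof. by rewrite -expRM_natl; congr expR; ring. Qed.

Lemma exp2_in01 x : 0 < x -> 0 < expR (- (2 * x)) < 1.
Proof. by move=> x0; rewrite expR_gt0 expR_lt1 oppr_lt0 mulr_gt0. Qed.

Lemma ln_geomG n x : 0 < x ->
  ln (geomG n (expR (- (2 * x)))) =
  ln n.+1%:R - n%:R * x + lsinhc (n.+1%:R * x) - lsinhc x.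
Proof.
move=> x0; have /andP[t0 t1] := exp2_in01 x x0.
have v0 : 0 < 1 - expR (- (2 * x)) by rewrite subr_gt0.
have g0 := @geomG_gt0 R n _ (ltW t0).
have n0 : 0 < n.+1%:R :> R by rewrite ltr0n.
have := congr1 (@ln R) (geomGE n (expR (- (2 * x)))).
rewrite lnM ?posrE// expRX !ln_one_sub_exp ?mulr_gt0// lnM ?posrE//.
by rewrite -!natr1; lra.
Qed.

(** Up to the factor [p], the derivative in [x] of the logarithm of the quotient
    of the two sides of the admissibility inequality at [t = exp (- 2 x)]. *)
Definition drift (m n N p x : R) :=
  N * langevin (N * p * x) - langevin (p * x)
  - m * langevin (m * x) - n * langevin (n * x) + 2 * langevin x.

(** The first inequality is the case [t = 1]; the quotient of the two sides then
    increases as [t] moves away from 1. *)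
Lemma admissible_at_of_drift r s p b : 0 < p -> 0 < b ->
  p * (ln r.+1%:R + ln s.+1%:R) <= ln (r + s).+1%:R :> R ->
  (forall x, 0 < x < b -> 0 <= drift r.+1%:R s.+1%:R (r + s).+1%:R p x) ->
  geomG r (expR (- (2 * b))) `^ p * geomG s (expR (- (2 * b))) `^ p
    <= geomG (r + s) (expR (- (2 * b)) `^ p).
Proof.
move=> p0 b0 end1 dr; set m : R := r.+1%:R; set n : R := s.+1%:R.
set N : R := (r + s).+1%:R.
have m0 : 0 < m by rewrite ltr0n.
have n0 : 0 < n by rewrite ltr0n.
have N0 : 0 < N by rewrite ltr0n.
have : 0 <= lsinhc (N * p * b) - lsinhc (p * b) - p * lsinhc (m * b)
            - p * lsinhc (n * b) + 2 * p * lsinhc b.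
  pose F x := lsinhc (N * p * x) - lsinhc (p * x) - p * lsinhc (m * x)
            - p * lsinhc (n * x) + 2 * p * lsinhc x.
  apply: (ge0_of_deriv F (fun x => p * drift m n N p x) (p + p * m + p * n) b b0).
  - move=> x /andP[x0 _].
    have D k : 0 < k -> has_deriv (fun x => lsinhc (k * x)) x (k * langevin (k * x)).
      by move=> k0; apply: deriv_scale; apply: deriv_lsinhc; rewrite mulr_gt0.
    apply: deriv_eq.
      apply: derivD; last by apply: derivZ; exact: deriv_lsinhc.
      apply: derivB; last by apply: derivZ; exact: D.
      apply: derivB; last by apply: derivZ; exact: D.
      by apply: derivB; apply: D => //; rewrite mulr_gt0.
    by rewrite /drift; ring.
  - by move=> x xb; rewrite mulr_ge0 ?(ltW p0)//; exact: dr.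
  - move=> x /andP[x0 _]; rewrite /F.
    have B k : 0 < k -> 0 <= lsinhc (k * x) <= k * x.
      by move=> k0; apply: lsinhc_bounds; rewrite mulr_gt0.
    have /andP[h1 _] := B _ (mulr_gt0 N0 p0); have /andP[_ h2] := B _ p0.
    have /andP[_ h3] := B _ m0; have /andP[_ h4] := B _ n0.
    have /andP[h5 _] := lsinhc_bounds x x0.
    have := ler_wpM2l (ltW p0) h3; have := ler_wpM2l (ltW p0) h4.
    have : 0 <= 2 * p * lsinhc x by rewrite !mulr_ge0 ?(ltW p0).
    by rewrite !mulrDl !mulrA; lra.
move=> F0.
have pb : 0 < p * b by rewrite mulr_gt0.
have -> : expR (- (2 * b)) `^ p = expR (- (2 * (p * b))).
  by rewrite powR_expR; congr expR; ring.
have g1 := @geomG_gt0 R r _ (expR_ge0 (- (2 * b))).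
have g2 := @geomG_gt0 R s _ (expR_ge0 (- (2 * b))).
have g3 := @geomG_gt0 R (r + s) _ (expR_ge0 (- (2 * (p * b)))).
rewrite -ler_ln ?posrE ?mulr_gt0 ?powR_gt0// lnM ?posrE ?powR_gt0//.
rewrite !ln_powR !ln_geomG// -/m -/n -/N (mulrA N) natrD.
rewrite -/m -/n -/N in end1.
rewrite -subr_ge0.
match goal with |- is_true (0 <= ?e) => have -> : e =
  (lsinhc (N * p * b) - lsinhc (p * b) - p * lsinhc (m * b)
   - p * lsinhc (n * b) + 2 * p * lsinhc b) + (ln N - p * (ln m + ln n)) by ring end.
by rewrite addr_ge0// subr_ge0.
Qed.

(** The tangent-line condition of [admissible_at_mono] in the variable
    [x = - ln t / 2]: it holds at [x = 0] by hypothesis, and its logarithm is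
    nondecreasing in [x]. *)
Lemma slope_of_langevin r s p b t : 0 < p < 1 -> 0 < b ->
  t = expR (- (2 * b)) ->
  p * r%:R <= (1 - p) * s.+1%:R ->
  ln p + p * ln r.+1%:R <= (1 - p) * ln s.+1%:R :> R ->
  (forall x, 0 < x < b -> r.+1%:R * langevin (r.+1%:R * x) <=
     r%:R * langevin (s.+1%:R * x) + 2 * langevin x - langevin (p * x)) ->
  (1 - t `^ p) * (geomG r t / (1 - t)) `^ p * (1 - t ^+ s.+1) `^ (p - 1)
    <= t `^ (p * r%:R) * (t ^+ s.+1) `^ (p - 1).
Proof.
move=> /andP[p0 p1] b0 tE dl end1 dr; set m : R := r.+1%:R in end1 dr *.
set n : R := s.+1%:R in dl end1 dr *.
have m0 : 0 < m by rewrite ltr0n.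
have n0 : 0 < n by rewrite ltr0n.
have q0 : 0 < 1 - p by rewrite subr_gt0.
pose d := (1 - p) * n - p * r%:R.
have d0 : 0 <= d by rewrite subr_ge0.
have : 0 <= (1 - p) * lsinhc (n * b) + 2 * p * lsinhc b - p * lsinhc (m * b)
            - lsinhc (p * b) + d * b.
  pose F x := (1 - p) * lsinhc (n * x) + 2 * p * lsinhc x - p * lsinhc (m * x)
            - lsinhc (p * x) + d * x.
  apply: (ge0_of_deriv F (fun x => d * (1 + langevin (n * x)) +
     p * (r%:R * langevin (n * x) + 2 * langevin x - langevin (p * x)
          - m * langevin (m * x))) (p * m + p) b b0).
  - move=> x /andP[x0 _].
    have D k : 0 < k -> has_deriv (fun x => lsinhc (k * x)) x (k * langevin (k * x)).
      by move=> k0; apply: deriv_scale; apply: deriv_lsinhc; rewrite mulr_gt0.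
    apply: deriv_eq.
      apply: derivD; last by apply: derivZ; exact: deriv_id.
      apply: derivB; last exact: D.
      apply: derivB; last by apply: derivZ; exact: D.
      apply: derivD; first by apply: derivZ; exact: D.
      by apply: derivZ; exact: deriv_lsinhc.
    by rewrite /d; ring.
  - move=> x xb; have /andP[x0 _] := xb.
    have nx : 0 < n * x by rewrite mulr_gt0.
    apply: addr_ge0; apply: mulr_ge0 => //; last by rewrite subr_ge0; exact: dr.
      by rewrite addr_ge0// ltW// langevin_gt0.
    exact: ltW.
  - move=> x /andP[x0 _]; rewrite /F.
    have B k : 0 < k -> 0 <= lsinhc (k * x) <= k * x.
      by move=> k0; apply: lsinhc_bounds; rewrite mulr_gt0.
    have /andP[h1 _] := B _ n0; have /andP[_ h2] := B _ p0.
    have /andP[_ h3] := B _ m0; have /andP[h5 _] := lsinhc_bounds x x0.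
    have := ler_wpM2l (ltW p0) h3; have := mulr_ge0 (ltW q0) h1.
    have : 0 <= 2 * p * lsinhc x by rewrite !mulr_ge0 ?(ltW p0).
    have : 0 <= d * x by rewrite mulr_ge0 ?(ltW x0).
    by rewrite !mulrDl !mulrA; lra.
move=> F0.
have pb : 0 < p * b by rewrite mulr_gt0.
have up : t `^ p = expR (- (2 * (p * b))).
  by rewrite tE powR_expR; congr expR; ring.
have /andP[t0 t1] : 0 < t < 1 by rewrite tE exp2_in01.
have v0 : 0 < 1 - t by rewrite subr_gt0.
have w0 : 0 < 1 - t `^ p by rewrite subr_gt0 powR_lt1// t0.
have z0 : 0 < 1 - t ^+ s.+1 by rewrite subr_gt0 exprn_ilt1// ltW.
have g0 := @geomG_gt0 R r t (ltW t0).
have h0 : 0 < geomG r t / (1 - t) by rewrite divr_gt0.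
have tp k : 0 < t ^+ k by rewrite exprn_gt0.
rewrite -ler_ln ?posrE ?mulr_gt0 ?powR_gt0//.
rewrite !lnM ?posrE ?mulr_gt0 ?powR_gt0// !ln_powR ln_div ?posrE//.
rewrite up tE ln_geomG// expRX !ln_one_sub_exp ?mulr_gt0// !expRK -/m -/n.
rewrite !lnM ?posrE//.
have mE : m = r%:R + 1 by rewrite /m natr1.
move: F0 end1; rewrite /d mE.
set L1 := ln (r%:R + 1); set L2 := ln n; set L3 := ln p; set L4 := ln b.
set L5 := ln 2.
set S1 := lsinhc (n * b); set S2 := lsinhc b; set S3 := lsinhc (_ * b).
set S4 := lsinhc (p * b) => F0 end1.
rewrite -subr_ge0.
match goal with |- is_true (0 <= ?e) => have -> : e =
  ((1 - p) * S1 + 2 * p * S2 - p * S3 - S4 + ((1 - p) * n - p * r%:R) * b) +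
  ((1 - p) * L2 - (L3 + p * L1)) by ring end.
by rewrite addr_ge0// subr_ge0.
Qed.

End NearOne.

(** * Comparison of linear combinations of Langevin values *)

Section Drift.
Context {R : realType}.
Implicit Types (x y t p a b m n q v e k u : R).

(** The Pade approximant of [langevin (a * x) / x], as a function of
    [X = x ^ 2]. *)
Definition pade X a : R := 5 * a / (15 + a ^+ 2 * X).

Lemma pade_den_gt0 X a : 0 <= X -> 0 < 15 + a ^+ 2 * X.
Proof. by move=> X0; rewrite ltr_wpDr// mulr_ge0// sqr_ge0. Qed.

Lemma pade_ge0 X a : 0 <= X -> 0 <= a -> 0 <= pade X a.
Proof. by move=> X0 a0; rewrite divr_ge0 ?mulr_ge0// ltW// pade_den_gt0. Qed.

Lemma langevin_padeE x a : 0 < x -> 0 < a ->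
  langevin (a * x) = pade_ratio (a * x) * (x * pade (x ^+ 2) a).
Proof.
move=> x0 a0; rewrite {1}langevin_pade ?mulr_gt0//; congr (_ * _).
by rewrite /pade exprMn; ring.
Qed.

(** A linear inequality between values of [langevin] follows from the same
    inequality between Pade approximants, because the ratio of the two is
    nondecreasing; only the remainder [rest] has to absorb the factor [K]. *)
Lemma langevin_comb_ge0 x q n m cq cn cm b K rest :
  0 < x -> 0 < m -> m <= n -> n <= q -> (q * x) ^+ 2 <= 10 ->
  0 <= cq -> 0 <= cn -> 0 <= b ->
  pade_ratio (m * x) <= K -> b * K * x <= rest ->
  cn * pade (x ^+ 2) n <= cq * pade (x ^+ 2) q ->
  cm * pade (x ^+ 2) m <= cq * pade (x ^+ 2) q - cn * pade (x ^+ 2) n + b ->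
  0 <= cq * langevin (q * x) - cn * langevin (n * x) - cm * langevin (m * x) + rest.
Proof.
move=> x0 m0 mn nq q10 cq0 cn0 b0 mK bK h1 h2.
have n0 := lt_le_trans m0 mn; have q0 := lt_le_trans n0 nq.
have X0 : 0 <= x ^+ 2 by exact: sqr_ge0.
have mnx : m * x <= n * x by rewrite ler_pM2r.
have nqx : n * x <= q * x by rewrite ler_pM2r.
have mx0 : 0 < m * x by rewrite mulr_gt0.
have nx0 : 0 < n * x by rewrite mulr_gt0.
have n10 : (n * x) ^+ 2 <= 10.
  by apply: le_trans q10; rewrite ler_pXn2r ?nnegrE ?(ltW nx0)// (le_trans (ltW nx0)).
have k1 := pade_ratio_nondecr (m * x) (n * x) mx0 mnx n10.
have k2 := pade_ratio_nondecr (n * x) (q * x) nx0 nqx q10.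
have /andP[km1 _] := pade_ratio_bounds (m * x) mx0.
rewrite !langevin_padeE//.
have Lq0 : 0 <= pade (x ^+ 2) q.
  by rewrite pade_ge0 ?(ltW q0).
set km := pade_ratio (m * x) in mK k1 km1 *.
set kn := pade_ratio (n * x) in k1 k2 *.
set kq := pade_ratio (q * x) in k2 *.
move: h1 h2 Lq0.
set Lq := pade _ q; set Ln := pade _ n; set Lm := pade _ m => h1 h2 Lq0.
have kn0 : 0 <= kn - km by rewrite subr_ge0.
have h3 : 0 <= (kq - kn) * (x * (cq * Lq)).
  by apply: mulr_ge0; [rewrite subr_ge0 | apply: mulr_ge0; [exact: ltW | exact: mulr_ge0]].
have h4 : 0 <= (kn - km) * (x * (cq * Lq - cn * Ln)).
  by apply: mulr_ge0 => //; apply: mulr_ge0; [exact: ltW | rewrite subr_ge0].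
have h5 : 0 <= km * (x * (cq * Lq - cn * Ln + b - cm * Lm)).
  apply: mulr_ge0; first exact: le_trans km1.
  by apply: mulr_ge0; [exact: ltW | rewrite subr_ge0].
have h6 : 0 <= (K - km) * (b * x).
  by apply: mulr_ge0; [rewrite subr_ge0 | apply: mulr_ge0 => //; exact: ltW].
by lra.
Qed.

(** At the exponent for which [v = p r / (1 - p)] is the critical value of
    [s + 1], the argument [(r + n) p] is the convex combination of [v] and [n]
    with weights [1 - p] and [p]; concavity then bounds the drift from below for
    [n] close to [v]. *)
Lemma drift_near_critical p r v n x : 0 < p < 1 -> 0 < v -> 0 < x ->
  p * r = (1 - p) * v -> v <= n ->
  (r - (1 - p) / v * (n - v) ^+ 2) * langevin (v * x)
    <= (r + n) * langevin ((r + n) * p * x) - n * langevin (n * x).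
Proof.
move=> /andP[p0 p1] v0 x0 prE vn.
have q0 : 0 < 1 - p by rewrite subr_gt0.
have n0 := lt_le_trans v0 vn.
have rE : r = (1 - p) * v / p by rewrite -prE mulrAC mulfV ?mul1r// gt_eqF.
have E : (r + n) * p * x = (1 - p) * (v * x) + p * (n * x).
  by rewrite [in LHS]rE; field; rewrite gt_eqF.
have vx0 : 0 < v * x by rewrite mulr_gt0.
have nx0 : 0 < n * x by rewrite mulr_gt0.
have p01 : 0 <= p <= 1 by rewrite !ltW.
have := langevin_concave p _ _ p01 vx0 nx0; rewrite -E.
have vq : v * x <= (r + n) * p * x.
  rewrite E; have : p * (v * x) <= p * (n * x) by rewrite ler_pM2l// ler_pM2r.
  by lra.
have := langevin_sublinear _ _ vx0 vq.
set Lq := langevin (_ * p * x); set Lv := langevin (v * x).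
set Ln := langevin (n * x) => h1 h2.
have Lv0 : 0 < Lv by rewrite langevin_gt0.
have {}h1 : v * Lq <= (v + p * (n - v)) * Lv.
  rewrite -(ler_pM2r x0).
  have -> : v * Lq * x = v * x * Lq by ring.
  have -> : (v + p * (n - v)) * Lv * x = (r + n) * p * x * Lv.
    by rewrite E; ring.
  exact: h1.
have h3 : 0 <= (n - v) * (1 - p) / (p * v).
  by apply: divr_ge0; apply: mulr_ge0; rewrite ?subr_ge0 ?(ltW p1) ?(ltW p0) ?(ltW v0).
have {}h1 := ler_wpM2l h3 h1.
have h4 : 0 <= n / p by rewrite divr_ge0 ?ltW.
have {}h2 := ler_wpM2l h4 h2.
rewrite -subr_ge0.
have -> : (r + n) * Lq - n * Ln - (r - (1 - p) / v * (n - v) ^+ 2) * Lv =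
   (n / p * Lq - n / p * ((1 - p) * Lv + p * Ln))
   + ((n - v) * (1 - p) / (p * v) * ((v + p * (n - v)) * Lv)
      - (n - v) * (1 - p) / (p * v) * (v * Lq)).
  by rewrite [in LHS]rE; field; rewrite (gt_eqF p0) (gt_eqF v0).
by apply: addr_ge0; rewrite subr_ge0.
Qed.

End Drift.

(** * Polynomial inequalities between Pade approximants *)

(** Linear arithmetic over the monomials of a nonnegative Bernstein expansion of
   degree [d] in [u] and degree at most [j] in [k]. *)
Ltac bernstein_row H j d :=
  match d with
  | 1%N => move: (H j 0 1)%N (H j 1 0)%N
  | 2%N => move: (H j 0 2)%N (H j 1 1)%N (H j 2 0)%N
  | 3%N => move: (H j 0 3)%N (H j 1 2)%N (H j 2 1)%N (H j 3 0)%N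
  end.
Ltac bernstein_rows H j d :=
  bernstein_row H j d;
  match j with S ?i => bernstein_rows H i d | O => idtac end.
Ltac bernstein H j d := bernstein_rows H j d; lra.

Section PadeInequalities.
Context {R : realType}.
Implicit Types (x y t p a b m n q v e k u X : R).

Lemma bernstein_ge0 k u : 0 <= k -> 0 <= u <= 1 ->
  forall i j l, 0 <= k ^+ i * (u ^+ j * (1 - u) ^+ l).
Proof.
move=> k0 /andP[u0 u1] i j l.
by rewrite !mulr_ge0 ?exprn_ge0// subr_ge0.
Qed.

(** The change of variables that maps the range of [(m, X)] onto
    [0 <= k], [0 <= u <= 1], where the Bernstein expansion can be used. *)
Lemma unit_scale m X : 3 <= m -> 0 <= X -> X * (m + 1) ^+ 2 <= 4 ->
  let k := m - 3 in let u := X * (m + 1) ^+ 2 / 4 in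
  [/\ 0 <= k, 0 <= u <= 1, m = k + 3 & X = 4 * u / (k + 4) ^+ 2].
Proof.
move=> m3 X0 X4 k u; split; rewrite /k /u ?subr_ge0 ?subrK//.
  by rewrite ler_pdivrMr// mul1r X4 andbT divr_ge0// mulr_ge0// sqr_ge0.
by field; lra.
Qed.

(** This and the two following lemmas are the cases [s = r], [s = r + 1] and
    [s >= r + 2] of the sign of the drift, with [m = r + 1], for Pade approximants
    in place of [langevin]. In the first two, [q] is [N p] for the smallest exponent [p]
    allowed, [(m + 2) / (2 m + 1)], with [N = r + s + 1]. The constant [39 / 100]
    is the share of the two remaining terms [2 langevin x - langevin (p x)]
    divided by [x], as estimated in [small_terms_ge]. *)
Lemma pade_gap_diag m q X : 3 <= m -> 0 <= X -> X * (m + 1) ^+ 2 <= 4 ->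
  q = (2 * m - 1) * (m + 2) / (2 * m + 1) ->
  2 * m * pade X m <= (2 * m - 1) * pade X q + 39 / 100.
Proof.
move=> m3 X0 X4 qE; have [] := unit_scale m X m3 X0 X4.
set k := m - 3; set u := _ / 4; clearbody u k => k0 u01 mE XE.
have Dm := pade_den_gt0 X m X0; have Dq := pade_den_gt0 X q X0.
rewrite -subr_ge0 /pade.
pose num := 5 * (2 * m - 1) * q * (15 + m ^+ 2 * X)
  - 10 * m ^+ 2 * (15 + q ^+ 2 * X)
  + 39 / 100 * (15 + q ^+ 2 * X) * (15 + m ^+ 2 * X).
have -> : (2 * m - 1) * (5 * q / (15 + q ^+ 2 * X)) + 39 / 100
  - 2 * m * (5 * m / (15 + m ^+ 2 * X)) =
  num / ((15 + q ^+ 2 * X) * (15 + m ^+ 2 * X)).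
  by rewrite /num; field; rewrite (gt_eqF Dm) (gt_eqF Dq).
apply: divr_ge0; last by rewrite ltW// mulr_gt0.
have d0 : 0 < (2 * m + 1) ^+ 2 * (k + 4) ^+ 4.
  by rewrite mulr_gt0// exprn_gt0//; lra.
rewrite -(pmulr_rge0 _ d0) /num.
pose M := k + 4; pose d := 2 * m + 1; pose n := (2 * m - 1) * (m + 2).
have -> : d ^+ 2 * M ^+ 4 * num =
  5 * (2 * m - 1) * n * d * M ^+ 2 * (15 * M ^+ 2 + 4 * m ^+ 2 * u)
  - 10 * m ^+ 2 * M ^+ 2 * (15 * d ^+ 2 * M ^+ 2 + 4 * n ^+ 2 * u)
  + 39 / 100 * (15 * d ^+ 2 * M ^+ 2 + 4 * n ^+ 2 * u)
    * (15 * M ^+ 2 + 4 * m ^+ 2 * u).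
  rewrite /num qE XE /n /d /M; field.
  by apply/andP; split; apply: lt0r_neq0; lra.
rewrite /n /d /M mE.
have H := bernstein_ge0 k u k0 u01.
bernstein H 7%N 2%N.
Qed.

Lemma pade_gap_next m q X : 3 <= m -> 0 <= X -> X * (m + 1) ^+ 2 <= 4 ->
  q = 2 * m * (m + 2) / (2 * m + 1) ->
  (m + 1) * pade X (m + 1) <= 2 * m * pade X q /\
  m * pade X m <= 2 * m * pade X q - (m + 1) * pade X (m + 1) + 39 / 100.
Proof.
move=> m3 X0 X4 qE; have [] := unit_scale m X m3 X0 X4.
set k := m - 3; set u := _ / 4; clearbody u k => k0 u01 mE XE.
have Dm := pade_den_gt0 X m X0; have Dq := pade_den_gt0 X q X0.
have Dn := pade_den_gt0 X (m + 1) X0.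
have H := bernstein_ge0 k u k0 u01.
pose M := k + 4; pose d := 2 * m + 1; pose n := 2 * m * (m + 2).
have M0 : 0 < M by rewrite /M; lra.
have d0 : 0 < d by rewrite /d; lra.
have dn0 : d != 0 by rewrite gt_eqF.
have Mn0 : M != 0 by rewrite gt_eqF.
have EDn : 15 + (m + 1) ^+ 2 * X = 15 + 4 * u.
  by rewrite XE mE; field; rewrite -/M.
split; rewrite -subr_ge0 /pade.
  pose num := 10 * m * q * (15 + (m + 1) ^+ 2 * X)
    - 5 * (m + 1) ^+ 2 * (15 + q ^+ 2 * X).
  have -> : 2 * m * (5 * q / (15 + q ^+ 2 * X))
    - (m + 1) * (5 * (m + 1) / (15 + (m + 1) ^+ 2 * X)) =
    num / ((15 + q ^+ 2 * X) * (15 + (m + 1) ^+ 2 * X)).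
    by rewrite /num; field; rewrite (gt_eqF Dn) (gt_eqF Dq).
  apply: divr_ge0; last by rewrite ltW// mulr_gt0.
  have dM0 : 0 < d ^+ 2 * M ^+ 2 by rewrite mulr_gt0// exprn_gt0.
  rewrite -(pmulr_rge0 _ dM0) /num EDn.
  have -> : d ^+ 2 * M ^+ 2 * (10 * m * q * (15 + 4 * u)
      - 5 * (m + 1) ^+ 2 * (15 + q ^+ 2 * X)) =
    10 * m * n * d * M ^+ 2 * (15 + 4 * u)
    - 5 * (m + 1) ^+ 2 * (15 * d ^+ 2 * M ^+ 2 + 4 * n ^+ 2 * u).
    by rewrite qE XE /n -/d -/M; field; rewrite dn0 Mn0.
  rewrite /n /d /M mE.
  bernstein H 6%N 1%N.
pose num := 10 * m * q * (15 + (m + 1) ^+ 2 * X) * (15 + m ^+ 2 * X)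
  - 5 * (m + 1) ^+ 2 * (15 + q ^+ 2 * X) * (15 + m ^+ 2 * X)
  - 5 * m ^+ 2 * (15 + q ^+ 2 * X) * (15 + (m + 1) ^+ 2 * X)
  + 39 / 100 * (15 + q ^+ 2 * X) * (15 + (m + 1) ^+ 2 * X) * (15 + m ^+ 2 * X).
have -> : 2 * m * (5 * q / (15 + q ^+ 2 * X))
  - (m + 1) * (5 * (m + 1) / (15 + (m + 1) ^+ 2 * X)) + 39 / 100
  - m * (5 * m / (15 + m ^+ 2 * X)) =
  num / ((15 + q ^+ 2 * X) * (15 + (m + 1) ^+ 2 * X) * (15 + m ^+ 2 * X)).
  by rewrite /num; field; rewrite (gt_eqF Dn) (gt_eqF Dq) (gt_eqF Dm).
apply: divr_ge0; last by rewrite ltW// !mulr_gt0.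
have dM0 : 0 < d ^+ 2 * M ^+ 4 by rewrite mulr_gt0// exprn_gt0.
rewrite -(pmulr_rge0 _ dM0) /num EDn.
match goal with |- is_true (0 <= ?e) => have -> : e =
  10 * m * n * d * M ^+ 2 * (15 + 4 * u) * (15 * M ^+ 2 + 4 * m ^+ 2 * u)
  - 5 * (m + 1) ^+ 2 * (15 * d ^+ 2 * M ^+ 2 + 4 * n ^+ 2 * u)
    * (15 * M ^+ 2 + 4 * m ^+ 2 * u)
  - 5 * m ^+ 2 * M ^+ 2 * (15 * d ^+ 2 * M ^+ 2 + 4 * n ^+ 2 * u) * (15 + 4 * u)
  + 39 / 100 * (15 * d ^+ 2 * M ^+ 2 + 4 * n ^+ 2 * u) * (15 + 4 * u)
    * (15 * M ^+ 2 + 4 * m ^+ 2 * u)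
end.
  by rewrite qE XE /n -/d -/M; field; rewrite dn0 Mn0.
rewrite /n /d /M mE.
bernstein H 7%N 3%N.
Qed.

Lemma pade_gap_far m e X : 3 <= m -> 0 <= X -> X * (m + 1) ^+ 2 <= 4 ->
  e * (m + 2) <= 1 / 2 ->
  m * pade X m <= (m - 1 - e) * pade X (m + 2) + 39 / 100.
Proof.
move=> m3 X0 X4 eE; have [] := unit_scale m X m3 X0 X4.
set k := m - 3; set u := _ / 4; clearbody u k => k0 u01 mE XE.
have Dm := pade_den_gt0 X m X0; have Dn := pade_den_gt0 X (m + 2) X0.
have H := bernstein_ge0 k u k0 u01.
rewrite -subr_ge0 /pade.
pose num c := 5 * ((m - 1) * (m + 2) - c) * (15 + m ^+ 2 * X)
  - 5 * m ^+ 2 * (15 + (m + 2) ^+ 2 * X)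
  + 39 / 100 * (15 + (m + 2) ^+ 2 * X) * (15 + m ^+ 2 * X).
have -> : (m - 1 - e) * (5 * (m + 2) / (15 + (m + 2) ^+ 2 * X)) + 39 / 100
  - m * (5 * m / (15 + m ^+ 2 * X)) =
  num (e * (m + 2)) / ((15 + (m + 2) ^+ 2 * X) * (15 + m ^+ 2 * X)).
  by rewrite /num; field; rewrite (gt_eqF Dm) (gt_eqF Dn).
apply: divr_ge0; last by rewrite ltW// mulr_gt0.
apply: (@le_trans _ _ (num (1 / 2))); last first.
  rewrite /num -subr_ge0.
  have -> : forall a b c : R, 5 * (a - e * (m + 2)) * (15 + m ^+ 2 * X) - b + c
    - (5 * (a - 1 / 2) * (15 + m ^+ 2 * X) - b + c) =
    5 * ((1 / 2 - e * (m + 2)) * (15 + m ^+ 2 * X)) by move=> *; ring.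
  by apply: mulr_ge0 => //; apply: mulr_ge0; [rewrite subr_ge0 | exact: ltW].
pose M := k + 4; have M0 : 0 < M by rewrite /M; lra.
have Mn0 : M != 0 by rewrite gt_eqF.
have M4 : 0 < M ^+ 4 by rewrite exprn_gt0.
rewrite -(pmulr_rge0 _ M4) /num.
match goal with |- is_true (0 <= ?e) => have -> : e =
  5 * ((m - 1) * (m + 2) - 1 / 2) * M ^+ 2 * (15 * M ^+ 2 + 4 * m ^+ 2 * u)
  - 5 * m ^+ 2 * M ^+ 2 * (15 * M ^+ 2 + 4 * (m + 2) ^+ 2 * u)
  + 39 / 100 * (15 * M ^+ 2 + 4 * (m + 2) ^+ 2 * u)
    * (15 * M ^+ 2 + 4 * m ^+ 2 * u)
end.
  by rewrite XE -/M; field; rewrite Mn0.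
rewrite /M mE.
bernstein H 6%N 2%N.
Qed.

End PadeInequalities.

(** * Sign of the drift for r at least 2 *)

Section DriftSign.
Context {R : realType}.
Implicit Types (x y t p a b m n q v e k u X : R) (r s : nat).

(** The factor [741 / 725] is the bound of [pade_ratio_le_K], which the argument
    of [langevin_comb_ge0] has to absorb. *)
Lemma small_terms_ge p x : 0 < x -> x ^+ 2 <= 1 / 4 -> 0 < p <= 3 / 4 ->
  39 / 100 * (741 / 725) * x <= 2 * langevin x - langevin (p * x).
Proof.
move=> x0 x4 /andP[p0 p34].
have := langevin_lower x (ltW x0).
have := langevin_le_third (p * x) (ltW (mulr_gt0 p0 x0)).
have : p * x <= 3 / 4 * x by rewrite ler_pM2r.
have : 20 * x / 61 <= 5 * x / (15 + x ^+ 2).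
  rewrite ler_pdivlMr; last by rewrite ltr_wpDr ?sqr_ge0.
  have : x * x ^+ 2 <= x * (1 / 4) by rewrite ler_pM2l.
  by lra.
by lra.
Qed.

Lemma pade_ratio_le_K y : 0 < y -> y ^+ 2 <= 4 -> pade_ratio y <= 741 / 725.
Proof.
move=> y0 y4; have /andP[_ /le_trans] := pade_ratio_bounds y y0; apply.
have := sqr_ge0 y; move: y4; set Y := y ^+ 2 => Y4 Y0.
have -> : 741 / 725 = 1 + 16 / 725 :> R by field.
rewrite lerD2l ler_pdivrMr; last by lra.
have : Y ^+ 2 <= 4 * Y by rewrite expr2 ler_wpM2r.
by lra.
Qed.

Section LargeR.
Variables (p m x : R).
Hypotheses (m3 : 3 <= m) (p34 : p <= 3 / 4) (plow : m + 2 <= (2 * m + 1) * p).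
Hypotheses (x0 : 0 < x) (xm : (m + 1) * x <= 2).

Let m0 : 0 < m. Proof. by move: m3; lra. Qed.

Let p_half : 1 / 2 < p.
Proof.
move: plow m3 => h1 h2; rewrite ltNge; apply/negP => p2.
have : (2 * m + 1) * p <= (2 * m + 1) * (1 / 2) by rewrite ler_wpM2l//; lra.
by lra.
Qed.

Let p0 : 0 < p. Proof. by move: p_half; lra. Qed.

Let X4 : x ^+ 2 * (m + 1) ^+ 2 <= 4.
Proof.
have -> : x ^+ 2 * (m + 1) ^+ 2 = ((m + 1) * x) ^+ 2 by ring.
have -> : 4 = 2 ^+ 2 :> R by ring.
by rewrite ler_pXn2r ?nnegrE// mulr_ge0 ?(ltW x0)//; move: m0; lra.
Qed.

Let ratio_m : pade_ratio (m * x) <= 741 / 725.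
Proof.
apply: pade_ratio_le_K; first by rewrite mulr_gt0.
have -> : 4 = 2 ^+ 2 :> R by ring.
rewrite ler_pXn2r ?nnegrE ?mulr_ge0 ?(ltW x0) ?(ltW m0)//.
by move: xm; rewrite mulrDl mul1r; move: x0; lra.
Qed.

Let x_half : x <= 1 / 2.
Proof.
have : 4 * x <= (m + 1) * x by rewrite ler_pM2r//; move: m3; lra.
by move: xm; lra.
Qed.

Let rest_ge : 39 / 100 * (741 / 725) * x <= 2 * langevin x - langevin (p * x).
Proof.
apply: small_terms_ge => //; last by rewrite p0.
have -> : 1 / 4 = (1 / 2) ^+ 2 :> R by field.
by rewrite ler_pXn2r ?nnegrE ?(ltW x0)//; lra.
Qed.

Let arg_le q : 0 <= q -> q <= m + 2 -> (q * x) ^+ 2 <= 10.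
Proof.
move=> q0 qm; have y0 : 0 <= q * x by rewrite mulr_ge0// ltW.
have y5 : q * x <= 5 / 2.
  have : q * x <= (m + 2) * x by rewrite ler_pM2r.
  by move: xm x_half; lra.
by rewrite expr2; apply: le_trans (ler_pM y0 y0 y5 y5) _; lra.
Qed.

(** By monotonicity of [langevin] it is enough to treat [v = m + 2]; [e] is the
    loss in the concavity bound of [drift_near_critical]. *)
Lemma drift_far v e : m + 2 <= v -> 0 <= e -> e * (m + 2) <= 1 / 2 ->
  m * langevin (m * x) <=
  (m - 1 - e) * langevin (v * x) + 2 * langevin x - langevin (p * x).
Proof.
move=> mv e0 em.
have e1 : e <= 1 / 2.
  have : e * 1 <= e * (m + 2) by apply: ler_wpM2l => //; move: m3; lra.
  by move: em; lra.
have := langevin_comb_ge0 x (m + 2) m m (m - 1 - e) 0 m (39 / 100) (741 / 725)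
  (2 * langevin x - langevin (p * x)).
have c0 : 0 <= m - 1 - e by move: m3; lra.
have m20 : 0 < m + 2 by move: m0; lra.
rewrite !mul0r !subr0 => /(_ x0 m0 (lexx _)) H.
have {}H : 0 <= (m - 1 - e) * langevin ((m + 2) * x) - m * langevin (m * x) +
    (2 * langevin x - langevin (p * x)).
  apply: H => //; first by lra.
  - by apply: arg_le => //; exact: ltW.
  - by apply: mulr_ge0 => //; rewrite pade_ge0 ?sqr_ge0 ?(ltW m20).
  - by apply: pade_gap_far => //; exact: sqr_ge0.
have : (m - 1 - e) * langevin ((m + 2) * x) <= (m - 1 - e) * langevin (v * x).
  apply: ler_wpM2l => //; apply: langevin_nondecr; first by rewrite mulr_gt0.
  by rewrite ler_pM2r.
by lra.
Qed.

Lemma drift_diag_ge0 : 0 <= drift m m (2 * m - 1) p x.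
Proof.
pose q := (2 * m - 1) * (m + 2) / (2 * m + 1).
have d0 : 0 < 2 * m + 1 by move: m0; lra.
have c0 : 0 < 2 * m - 1 by move: m3; lra.
have mq : m <= q.
  rewrite ler_pdivlMr//; have : 3 * m <= m * m by rewrite ler_pM2r.
  by move: m3; lra.
have q0 := lt_le_trans m0 mq.
have qm : q <= m + 2.
  by rewrite ler_pdivrMr//; move: m3; nra.
have := langevin_comb_ge0 x q m m (2 * m - 1) 0 (2 * m) (39 / 100) (741 / 725)
  (2 * langevin x - langevin (p * x)).
rewrite !mul0r !subr0 => /(_ x0 m0 (lexx _) mq (arg_le q (ltW q0) qm)) H.
have {}H : 0 <= (2 * m - 1) * langevin (q * x) - 2 * m * langevin (m * x) +
    (2 * langevin x - langevin (p * x)).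
  apply: H => //; rewrite ?(ltW c0)//.
  - by apply: mulr_ge0; [exact: ltW | rewrite pade_ge0 ?sqr_ge0 ?(ltW q0)].
  - by apply: pade_gap_diag => //; exact: sqr_ge0.
have : (2 * m - 1) * langevin (q * x) <=
       (2 * m - 1) * langevin ((2 * m - 1) * p * x).
  apply: ler_wpM2l; first exact: ltW.
  apply: langevin_nondecr; first by rewrite mulr_gt0.
  rewrite ler_pM2r// /q ler_pdivrMr// -!mulrA ler_pM2l//.
  by rewrite (mulrC p).
by rewrite /drift; lra.
Qed.

Lemma drift_next_ge0 : 0 <= drift m (m + 1) (2 * m) p x.
Proof.
pose q := 2 * m * (m + 2) / (2 * m + 1).
have d0 : 0 < 2 * m + 1 by move: m0; lra.
have c0 : 0 < 2 * m by move: m3; lra.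
have mq : m + 1 <= q by rewrite ler_pdivlMr//; move: m3; nra.
have q0 : 0 < q by apply: lt_le_trans mq; move: m0; lra.
have qm : q <= m + 2 by rewrite ler_pdivrMr//; move: m3; nra.
have m1 : 0 <= m + 1 by move: m0; lra.
have mm : m <= m + 1 by lra.
have [G1 G2] := pade_gap_next m q (x ^+ 2) m3 (sqr_ge0 x) X4 erefl.
have b0 : 0 <= 39 / 100 :> R by lra.
have H := langevin_comb_ge0 x q (m + 1) m (2 * m) (m + 1) m (39 / 100) (741 / 725)
  (2 * langevin x - langevin (p * x)) x0 m0 mm mq (arg_le q (ltW q0) qm)
  (ltW c0) m1 b0 ratio_m rest_ge G1 G2.
have : 2 * m * langevin (q * x) <= 2 * m * langevin (2 * m * p * x).
  apply: ler_wpM2l; first exact: ltW.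
  apply: langevin_nondecr; first by rewrite mulr_gt0.
  rewrite ler_pM2r// /q ler_pdivrMr// -(mulrA _ p) ler_pM2l//.
  by rewrite (mulrC p).
by move: H; rewrite /drift; lra.
Qed.

End LargeR.

Lemma drift_ge0_large r s p x : (2 <= r)%N -> (r <= s)%N -> p <= 3 / 4 ->
  r.+1%:R + 2 <= (2 * r.+1%:R + 1) * p -> 0 < x -> (r.+1%:R + 1) * x <= 2 ->
  (1 - p) * s%:R <= p * r%:R ->
  0 <= drift r.+1%:R s.+1%:R (r + s).+1%:R p x.
Proof.
move=> r2 rs p34 plow x0 xm sv.
have m3 : 3 <= r.+1%:R :> R by rewrite ler_nat.
case: (ltngtP s r) rs => // [rs _|-> _]; last first.
  have -> : (r + r).+1%:R = 2 * r.+1%:R - 1 :> R by rewrite -natr1 natrD -natr1; ring.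
  exact: drift_diag_ge0.
case: (ltngtP s r.+1) rs => // [rs _|-> _]; last first.
  have -> : r.+2%:R = r.+1%:R + 1 :> R by rewrite -natr1.
  have -> : (r + r.+1).+1%:R = 2 * r.+1%:R :> R by rewrite -natr1 natrD -natr1; ring.
  exact: drift_next_ge0.
have rE : r%:R = r.+1%:R - 1 :> R by rewrite -natr1 addrK.
have NE : (r + s).+1%:R = r.+1%:R - 1 + s.+1%:R :> R by rewrite -addnS natrD rE.
have sE : s%:R = s.+1%:R - 1 :> R by rewrite -[s.+1%:R]natr1 addrK.
have mn : r.+1%:R + 2 <= s.+1%:R :> R by rewrite -natrD ler_nat; lia.
rewrite NE; move: plow xm sv mn m3; rewrite rE sE.
set m : R := r.+1%:R; set n : R := s.+1%:R => plow xm sv mn m3.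
have p_half : 1 / 2 < p.
  rewrite ltNge; apply/negP => p2.
  have : (2 * m + 1) * p <= (2 * m + 1) * (1 / 2) by rewrite ler_wpM2l//; lra.
  by lra.
have q0 : 0 < 1 - p by lra.
have p01 : 0 < p < 1 by apply/andP; split; lra.
pose v := p * (m - 1) / (1 - p).
have prE : p * (m - 1) = (1 - p) * v by rewrite /v; field; rewrite gt_eqF.
have mv : m + 2 <= v by rewrite /v ler_pdivlMr//; move: plow; lra.
have v0 : 0 < v by lra.
(* For [n < v] the argument [(r + n) p] is at least [n], and monotonicity is
   enough; for [v <= n <= v + 1] the concavity bound loses at most
   [(1 - p) / v]. *)
have [vn|nv] := leP v n.
  have nv1 : n <= v + 1.
    by rewrite -lerBlDr /v ler_pdivlMr// mulrC.
  have := drift_near_critical p (m - 1) v n x p01 v0 x0 prE vn.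
  have e0 : 0 <= (1 - p) / v by rewrite divr_ge0// ltW.
  have t0 : 0 <= (n - v) ^+ 2 by exact: sqr_ge0.
  have t1 : (n - v) ^+ 2 <= 1.
    by rewrite expr_le1// ?subr_ge0// lerBlDl.
  have em : (1 - p) / v * (n - v) ^+ 2 * (m + 2) <= 1 / 2.
    rewrite mulrAC; apply: (@le_trans _ _ ((1 - p) / v * (m + 2) * 1)).
      by rewrite ler_wpM2l// mulr_ge0//; lra.
    rewrite mulr1.
    apply: (@le_trans _ _ (1 - p)); last by lra.
    by rewrite mulrAC ler_pdivrMr// ler_pM2l.
  have := drift_far p m x m3 p34 plow x0 xm v _ mv (mulr_ge0 e0 t0) em.
  by rewrite /drift; lra.
have e0 : 0 * (m + 2) <= 1 / 2 :> R by rewrite mul0r; lra.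
have nq : n <= (m - 1 + n) * p.
  have := ltW nv; rewrite -(ler_pM2l q0) -prE; lra.
have mq : m + 2 <= (m - 1 + n) * p by exact: le_trans nq.
have := drift_far p m x m3 p34 plow x0 xm _ 0 mq (lexx _) e0; rewrite subr0.
have n0 : 0 < n by lra.
have : n * langevin (n * x) <= n * langevin ((m - 1 + n) * p * x).
  rewrite ler_pM2l//; apply: langevin_nondecr; first by rewrite mulr_gt0.
  by rewrite ler_pM2r.
by rewrite /drift; lra.
Qed.

End DriftSign.

(** * Sign of the drift for r = 1 *)

Section DriftSignOne.
Context {R : realType}.
Implicit Types (x y t p a b m n q v e k u X : R) (r s : nat).

Lemma unit_bernstein X : 0 <= X <= 481 / 1000 -> exists2 u, X = 481 / 1000 * u &
  forall i j l : nat, 0 <= 0 ^+ i * (u ^+ j * (1 - u) ^+ l).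
Proof.
move=> /andP[X0 X1]; exists (X * (1000 / 481)); first by field.
apply: bernstein_ge0 => //; lra.
Qed.

Section ROne.
Variables (p x : R).
Hypotheses (plow : 17 / 22 <= p) (pup : p <= 7 / 9).
Hypotheses (x0 : 0 < x) (xX : x ^+ 2 <= 481 / 1000).

Let X := x ^+ 2.
Let X01 : 0 <= X <= 481 / 1000. Proof. by rewrite sqr_ge0. Qed.
Let X0 : 0 <= X. Proof. exact: sqr_ge0. Qed.

Let rest_one : 389 / 1000 * (1006 / 1000) * x <= 2 * langevin x - langevin (p * x).
Proof.
have h1 := langevin_lower x (ltW x0).
have p0 : 0 < p by move: plow; lra.
have px0 : 0 < p * x by rewrite mulr_gt0.
have h2 : langevin (p * x) <= langevin (7 / 9 * x).
  by apply: langevin_nondecr => //; rewrite ler_pM2r.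
have y0 : 0 <= 7 / 9 * x by rewrite mulr_ge0// ltW.
have := langevin_upper (7 / 9 * x) y0.
rewrite exprMn -/X; set P := (7 / 9) ^+ 2 * X.
have P0 : 0 <= P by rewrite mulr_ge0// sqr_ge0.
have -> : 7 / 9 * x * (35 + P) / (105 + 10 * P) =
  x * (7 / 9 * (35 + P) / (105 + 10 * P)) by ring.
have D1 : 0 < 15 + X by move: X0; lra.
have D2 : 0 < 105 + 10 * P by lra.
move: h1; rewrite -/X.
have -> : 5 * x / (15 + X) = x * (5 / (15 + X)) by ring.
have : x * (389 / 1000 * (1006 / 1000)) <=
  x * (2 * (5 / (15 + X)) - 7 / 9 * (35 + P) / (105 + 10 * P)).
  rewrite ler_pM2l// -subr_ge0.
  have -> : 2 * (5 / (15 + X)) - 7 / 9 * (35 + P) / (105 + 10 * P)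
    - 389 / 1000 * (1006 / 1000) =
    (10 * (105 + 10 * P) - 7 / 9 * (35 + P) * (15 + X)
     - 389 / 1000 * (1006 / 1000) * (15 + X) * (105 + 10 * P))
    / ((15 + X) * (105 + 10 * P)).
    by field; rewrite (gt_eqF D1) (gt_eqF D2).
  apply: divr_ge0; last by rewrite ltW// mulr_gt0.
  have [u XE H] := unit_bernstein X X01.
  rewrite /P XE.
  bernstein H 0%N 2%N.
by lra.
Qed.

Let ratio_one : pade_ratio (2 * x) <= 1006 / 1000.
Proof.
have y0 : 0 < 2 * x by rewrite mulr_gt0.
have /andP[_ /le_trans] := pade_ratio_bounds _ y0; apply.
have -> : (2 * x) ^+ 2 = 4 * X by rewrite /X; ring.
have -> : 1006 / 1000 = 1 + 6 / 1000 :> R by field.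
have D0 : 0 < 525 + 50 * (4 * X) by move: X0; lra.
rewrite lerD2l (ler_pdivrMr _ _ D0).
have [u XE H] := unit_bernstein X X01.
by rewrite -subr_ge0 XE; bernstein H 0%N 2%N.
Qed.

Let arg_one q : 0 <= q -> q <= 7 / 2 -> (q * x) ^+ 2 <= 10.
Proof.
move=> q0 q7; rewrite exprMn.
have : q ^+ 2 <= 49 / 4.
  by rewrite expr2; apply: le_trans (ler_pM q0 q0 q7 q7) _; lra.
have := X01; rewrite -/X => /andP[h1 h2] h3.
apply: (@le_trans _ _ (49 / 4 * (481 / 1000))); last by lra.
by apply: ler_pM => //; exact: sqr_ge0.
Qed.

(** The number [17 / 5] is the smallest value of [p / (1 - p)] for
    [p >= 17 / 22], and [9 / 374] the largest loss in [drift_near_critical] for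
    [n = 4]. *)
Lemma drift_far_one v e : 17 / 5 <= v -> 0 <= e <= 9 / 374 ->
  2 * langevin (2 * x) <=
  (1 - e) * langevin (v * x) + 2 * langevin x - langevin (p * x).
Proof.
move=> v34 /andP[e0 e9].
have c0 : 0 <= 1 - e by lra.
have D2 := pade_den_gt0 X 2 X0; have D3 := pade_den_gt0 X (17 / 5) X0.
have G : 2 * pade X 2 <= (1 - e) * pade X (17 / 5) - 0 * pade X 2 + 389 / 1000.
  rewrite mul0r subr0.
  apply: (@le_trans _ _ ((1 - 9 / 374) * pade X (17 / 5) + 389 / 1000)); last first.
    rewrite lerD2r; apply: ler_wpM2r; first by rewrite pade_ge0// divr_ge0.
    by lra.
  rewrite -subr_ge0 /pade.
  have -> : (1 - 9 / 374) * (5 * (17 / 5) / (15 + (17 / 5) ^+ 2 * X)) + 389 / 1000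
      - 2 * (5 * 2 / (15 + 2 ^+ 2 * X)) =
    ((1 - 9 / 374) * 17 * (15 + 2 ^+ 2 * X) - 20 * (15 + (17 / 5) ^+ 2 * X)
     + 389 / 1000 * (15 + 2 ^+ 2 * X) * (15 + (17 / 5) ^+ 2 * X))
    / ((15 + (17 / 5) ^+ 2 * X) * (15 + 2 ^+ 2 * X)).
    by field; rewrite ?(gt_eqF D2) ?(gt_eqF D3)//; apply/andP; split; apply: lt0r_neq0; move: X0; lra.
  apply: divr_ge0; last by rewrite ltW// mulr_gt0.
  have [u XE H] := unit_bernstein X X01.
  by rewrite XE; bernstein H 0%N 2%N.
have := langevin_comb_ge0 x (17 / 5) 2 2 (1 - e) 0 2 (389 / 1000) (1006 / 1000)
  (2 * langevin x - langevin (p * x)) x0.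
have z2 : 0 < 2 :> R by [].
have z34 : 2 <= 17 / 5 :> R by lra.
have z341 : 0 <= 17 / 5 :> R by lra.
have z342 : 17 / 5 <= 7 / 2 :> R by lra.
have zb : 0 <= 389 / 1000 :> R by lra.
have G0 : 0 * pade (x ^+ 2) 2 <= (1 - e) * pade (x ^+ 2) (17 / 5).
  by rewrite mul0r mulr_ge0// pade_ge0.
move=> /(_ z2 (lexx _) z34 (arg_one _ z341 z342) c0 (lexx _) zb ratio_one rest_one G0 G).
rewrite mul0r subr0 => h.
have : (1 - e) * langevin (17 / 5 * x) <= (1 - e) * langevin (v * x).
  apply: ler_wpM2l => //; apply: langevin_nondecr; first by rewrite mulr_gt0//; lra.
  by rewrite ler_pM2r.
by lra.
Qed.

(** Here and in the next lemma [langevin] is taken at [N p x] for the smallest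
    exponent [p = 17 / 22], which gives [51 / 22] and [34 / 11]. *)
Lemma drift_one_one_ge0 : 0 <= drift 2 2 3 p x.
Proof.
have D2 := pade_den_gt0 X 2 X0; have D3 := pade_den_gt0 X (51 / 22) X0.
have G : 4 * pade X 2 <= 3 * pade X (51 / 22) - 0 * pade X 2 + 389 / 1000.
  rewrite mul0r subr0 -subr_ge0 /pade.
  have -> : 3 * (5 * (51 / 22) / (15 + (51 / 22) ^+ 2 * X)) + 389 / 1000
      - 4 * (5 * 2 / (15 + 2 ^+ 2 * X)) =
    (15 * (51 / 22) * (15 + 2 ^+ 2 * X) - 40 * (15 + (51 / 22) ^+ 2 * X)
     + 389 / 1000 * (15 + 2 ^+ 2 * X) * (15 + (51 / 22) ^+ 2 * X))
    / ((15 + (51 / 22) ^+ 2 * X) * (15 + 2 ^+ 2 * X)).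
    by field; rewrite ?(gt_eqF D2) ?(gt_eqF D3)//; apply/andP; split; apply: lt0r_neq0; move: X0; lra.
  apply: divr_ge0; last by rewrite ltW// mulr_gt0.
  have [u XE H] := unit_bernstein X X01.
  by rewrite XE; bernstein H 0%N 2%N.
have := langevin_comb_ge0 x (51 / 22) 2 2 3 0 4 (389 / 1000) (1006 / 1000)
  (2 * langevin x - langevin (p * x)) x0.
have z2 : 0 < 2 :> R by [].
have z3 : 0 <= 3 :> R by [].
have z34 : 2 <= 51 / 22 :> R by lra.
have z341 : 0 <= 51 / 22 :> R by lra.
have z342 : 51 / 22 <= 7 / 2 :> R by lra.
have zb : 0 <= 389 / 1000 :> R by lra.
have G0 : 0 * pade (x ^+ 2) 2 <= 3 * pade (x ^+ 2) (51 / 22).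
  by rewrite mul0r mulr_ge0// pade_ge0.
move=> /(_ z2 (lexx _) z34 (arg_one _ z341 z342) z3 (lexx _) zb ratio_one rest_one G0 G).
rewrite mul0r subr0 => h.
have : langevin (51 / 22 * x) <= langevin (3 * p * x).
  apply: langevin_nondecr; first by rewrite mulr_gt0//; lra.
  by rewrite ler_pM2r//; move: plow; lra.
by rewrite /drift; lra.
Qed.

Lemma drift_one_two_ge0 : 0 <= drift 2 3 4 p x.
Proof.
have D2 := pade_den_gt0 X 2 X0; have D3 := pade_den_gt0 X 3 X0.
have Dq := pade_den_gt0 X (34 / 11) X0.
have [u XE H] := unit_bernstein X X01.
have G0 : 3 * pade X 3 <= 4 * pade X (34 / 11).
  rewrite -subr_ge0 /pade.
  have -> : 4 * (5 * (34 / 11) / (15 + (34 / 11) ^+ 2 * X))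
      - 3 * (5 * 3 / (15 + 3 ^+ 2 * X)) =
    (20 * (34 / 11) * (15 + 3 ^+ 2 * X) - 45 * (15 + (34 / 11) ^+ 2 * X))
    / ((15 + (34 / 11) ^+ 2 * X) * (15 + 3 ^+ 2 * X)).
    by field; rewrite ?(gt_eqF Dq) ?(gt_eqF D3)//; apply/andP; split; apply: lt0r_neq0; move: X0; lra.
  apply: divr_ge0; last by rewrite ltW// mulr_gt0.
  by rewrite XE; bernstein H 0%N 1%N.
have G : 2 * pade X 2 <= 4 * pade X (34 / 11) - 3 * pade X 3 + 389 / 1000.
  rewrite -subr_ge0 /pade.
  have -> : 4 * (5 * (34 / 11) / (15 + (34 / 11) ^+ 2 * X))
      - 3 * (5 * 3 / (15 + 3 ^+ 2 * X)) + 389 / 1000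
      - 2 * (5 * 2 / (15 + 2 ^+ 2 * X)) =
    (20 * (34 / 11) * (15 + 3 ^+ 2 * X) * (15 + 2 ^+ 2 * X)
     - 45 * (15 + (34 / 11) ^+ 2 * X) * (15 + 2 ^+ 2 * X)
     - 20 * (15 + (34 / 11) ^+ 2 * X) * (15 + 3 ^+ 2 * X)
     + 389 / 1000 * (15 + (34 / 11) ^+ 2 * X) * (15 + 3 ^+ 2 * X) * (15 + 2 ^+ 2 * X))
    / ((15 + (34 / 11) ^+ 2 * X) * (15 + 3 ^+ 2 * X) * (15 + 2 ^+ 2 * X)).
    by field; rewrite ?(gt_eqF Dq) ?(gt_eqF D3) ?(gt_eqF D2)//; do ?[apply/andP; split]; apply: lt0r_neq0; move: X0; lra.
  apply: divr_ge0; last by rewrite ltW// !mulr_gt0.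
  by rewrite XE; bernstein H 0%N 3%N.
have z2 : 0 < 2 :> R by [].
have z23 : 2 <= 3 :> R by lra.
have z3 : 0 <= 3 :> R by [].
have z4 : 0 <= 4 :> R by [].
have z34 : 3 <= 34 / 11 :> R by lra.
have z341 : 0 <= 34 / 11 :> R by lra.
have z342 : 34 / 11 <= 7 / 2 :> R by lra.
have zb : 0 <= 389 / 1000 :> R by lra.
have h := langevin_comb_ge0 x (34 / 11) 3 2 4 3 2 (389 / 1000) (1006 / 1000)
  (2 * langevin x - langevin (p * x)) x0 z2 z23 z34 (arg_one _ z341 z342) z4 z3
  zb ratio_one rest_one G0 G.
have : langevin (34 / 11 * x) <= langevin (4 * p * x).
  apply: langevin_nondecr; first by rewrite mulr_gt0//; lra.
  by rewrite ler_pM2r//; move: plow; lra.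
by move: h; rewrite /drift; lra.
Qed.

(** Here [v = p / (1 - p)] is between [17 / 5] and [7 / 2], and the drift is bounded by
    concavity. *)
Lemma drift_one_three_ge0 : 0 <= drift 2 4 5 p x.
Proof.
have p01 : 0 < p < 1 by move: plow pup => h1 h2; apply/andP; split; lra.
have q0 : 0 < 1 - p by move: pup; lra.
pose v := p / (1 - p).
have prE : p * 1 = (1 - p) * v by rewrite /v; field; rewrite gt_eqF.
have v34 : 17 / 5 <= v by rewrite /v ler_pdivlMr//; move: plow; lra.
have v35 : v <= 7 / 2 by rewrite /v ler_pdivrMr//; move: pup; lra.
have v0 : 0 < v by lra.
have v4 : v <= 4 by lra.
have := drift_near_critical p 1 v 4 x p01 v0 x0 prE v4.
have e9 : 0 <= (1 - p) / v * (4 - v) ^+ 2 <= 9 / 374.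
  have h1 : 0 <= (1 - p) / v by rewrite divr_ge0 ?ltW.
  have h2 : (1 - p) / v <= 25 / 374.
    by rewrite ler_pdivrMr//; move: plow v34; lra.
  have h3 : (4 - v) ^+ 2 <= 9 / 25.
    have v40 : 0 <= 4 - v by lra.
    have v43 : 4 - v <= 3 / 5 by lra.
    by rewrite expr2; apply: le_trans (ler_pM v40 v40 v43 v43) _; lra.
  rewrite mulr_ge0 ?sqr_ge0//=.
  by apply: le_trans (ler_pM h1 (sqr_ge0 _) h2 h3) _; lra.
have := drift_far_one v _ v34 e9.
have -> : 1 + 4 = 5 :> R by ring.
by rewrite /drift; lra.
Qed.

End ROne.
End DriftSignOne.

(** * Small arguments *)

Section SmallT.
Context {R : realType}.
Implicit Types (x y t p q a b w z e : R) (r s : nat).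

Lemma geomG_one t : geomG 1 t = 1 + t.
Proof. by rewrite /geomG !big_ord_recl big_ord0 expr0 expr1 addr0. Qed.

Lemma powR_le_rat a b p (i j : nat) : 1 <= a -> 0 < b -> (0 < j)%N ->
  p <= i%:R / j%:R -> a ^+ i <= b ^+ j -> a `^ p <= b.
Proof.
move=> a1 b0 j0 pij ab.
apply: (@le_trans _ _ (a `^ (i%:R / j%:R))); first exact: ler_powR.
have a0 : 0 <= a by exact: le_trans a1.
have j1 : 0 < j%:R :> R by rewrite ltr0n.
rewrite -(@ler_pXn2r _ j)// ?nnegrE ?powR_ge0 ?(ltW b0)//.
by rewrite -powR_mulrn ?powR_ge0// -powRrM divfK ?gt_eqF// powR_mulrn.
Qed.

(** Both powers are linearised by the Bernoulli inequality, the first around 1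
    and the second around [t = 1 / 4]; what is left is linear in [t], and
    [4 ^ p <= 47 / 16] settles it at both ends. *)
Lemma small_t_one p t : 1 / 2 < p -> p <= 24 / 31 -> 0 < t <= 1 / 4 ->
  (1 - t `^ p) * geomG 1 t `^ (2 * p - 1) <= 1 - t.
Proof.
move=> p2 p31 /andP[t0 t4].
have p0 : 0 < p by lra.
have tp := powR_gt0 p t0.
have tp1 : t `^ p < 1 by apply: powR_lt1 => //; apply/andP; split => //; lra.
have c01 : 0 <= 2 * p - 1 <= 1 by apply/andP; split; lra.
have h1 : geomG 1 t `^ (2 * p - 1) <= 1 + (2 * p - 1) * t.
  rewrite geomG_one; have := powR_bernoulli (2 * p - 1) (1 + t) c01.
  by rewrite addrAC subrr add0r; apply; lra.
have u0 : 0 <= 1 - t `^ p by rewrite subr_ge0 ltW.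
apply: le_trans (ler_wpM2l u0 h1) _.
have h4 : 4 `^ p <= 47 / 16.
  apply: (powR_le_rat 4 (47 / 16) p 24 31) => //; first by lra.
  by rewrite expr_div_n ler_pdivlMr ?exprn_gt0//; lra.
have q01 : 0 <= 1 - p <= 1 by apply/andP; split; lra.
have t40 : 0 < 4 * t by rewrite mulr_gt0.
have := powR_bernoulli (1 - p) (4 * t) q01 t40.
rewrite powRM ?(ltW t0)// !powR_subr1// => h.
have f0 : 0 < 4 `^ p :> R by rewrite powR_gt0.
have {h} : 4 * t <= (1 + (1 - p) * (4 * t - 1)) * (4 `^ p * t `^ p).
  move: h; rewrite -(ler_pM2r (mulr_gt0 f0 tp)); apply: le_trans.
  by rewrite le_eqVlt; apply/orP; left; apply/eqP; field; rewrite !gt_eqF.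
have k0 : 0 <= 1 + (1 - p) * (4 * t - 1).
  have : 0 <= (1 - p) * (4 * t) by rewrite mulr_ge0 ?ltW//; lra.
  by lra.
have : (1 + (1 - p) * (4 * t - 1)) * (4 `^ p * t `^ p) <=
   (1 + (1 - p) * (4 * t - 1)) * (47 / 16 * t `^ p).
  by apply: ler_wpM2l => //; rewrite ler_pM2r.
move=> h2 h3.
have h5 : 2 * p * t <= (1 + (2 * p - 1) * t) * t `^ p.
  have h6 : p / 2 * (4 * t) <= p / 2 * ((1 + (1 - p) * (4 * t - 1)) * (47 / 16 * t `^ p)).
    by rewrite ler_wpM2l ?(le_trans h3 h2)// divr_ge0// ltW.
  have h7 : p / 2 * ((1 + (1 - p) * (4 * t - 1)) * (47 / 16)) * t `^ p <=
     (1 + (2 * p - 1) * t) * t `^ p.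
    rewrite ler_pM2r// -subr_ge0.
    have -> : 1 + (2 * p - 1) * t - p / 2 * ((1 + (1 - p) * (4 * t - 1)) * (47 / 16))
      = (1 - 4 * t) * (1 - 47 / 32 * (p * p)) + 4 * t * (3 / 4 - 31 / 32 * p).
      by field.
    have pp : p * p <= 24 / 31 * (24 / 31) by rewrite ler_pM// ltW.
    by apply: addr_ge0; apply: mulr_ge0; lra.
  have -> : 2 * p * t = p / 2 * (4 * t) by field.
  by apply: le_trans h6 _; apply: le_trans h7; rewrite !mulrA.
by lra.
Qed.

(** Since [(1 - t) G_r(t) <= 1], it is enough to have the inequality with
    [G_r(t)] replaced by [1 / (1 - t)]. *)
Lemma small_t_of_threshold r p t : 1 / 2 < p -> 0 < t < 1 ->
  1 - t `^ p <= (1 - t) `^ (2 * p) ->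
  (1 - t `^ p) * geomG r t `^ (2 * p - 1) <= 1 - t.
Proof.
move=> p2 /andP[t0 t1] psi; have v0 : 0 < 1 - t by rewrite subr_gt0.
have g0 := @geomG_gt0 R r t (ltW t0).
have vg : (1 - t) * geomG r t <= 1.
  by rewrite geomGE; have := exprn_ge0 r.+1 (ltW t0); lra.
apply: le_trans (ler_wpM2r (powR_ge0 _ _) psi) _.
have -> : (1 - t) `^ (2 * p) = (1 - t) * (1 - t) `^ (2 * p - 1).
  by rewrite powR_subl1//; field; rewrite gt_eqF.
rewrite -mulrA -powRM ?(ltW v0) ?(ltW g0)//.
rewrite ler_piMr ?(ltW v0)//.
apply: (@le_trans _ _ (1 `^ (2 * p - 1))); last by rewrite powR1.
apply: ge0_ler_powR => //; rewrite ?nnegrE ?mulr_ge0 ?(ltW v0) ?(ltW g0)//.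
by lra.
Qed.

(** The chord of [x ^ q] from [a] to 1 lies below the graph at [b]. *)
Lemma powR_chord q a b : 0 <= q <= 1 -> 0 < a -> a <= b -> b < 1 ->
  (1 - b) * a `^ q + (b - a) <= (1 - a) * b `^ q.
Proof.
move=> q01 a0 ab b1; have b0 := lt_le_trans a0 ab.
have bq := powR_gt0 q b0.
have T w : 0 < w -> w `^ q <= b `^ q * (1 + q * (w / b - 1)).
  move=> w0; have -> : w `^ q = b `^ q * (w / b) `^ q.
    rewrite -powRM ?(ltW b0) ?divr_ge0 ?(ltW w0) ?(ltW b0)//.
    by congr (_ `^ _); field; rewrite gt_eqF.
  by rewrite ler_pM2l// powR_bernoulli// divr_gt0.
have h1 := T a a0; have := T 1 ltr01; rewrite powR1 => h2.
have b1' : 0 <= 1 - b by lra.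
have ba' : 0 <= b - a by lra.
have {}h1 := ler_wpM2l b1' h1; have {}h2 := ler_wpM2l ba' h2.
have -> : (1 - a) * b `^ q = (1 - b) * (b `^ q * (1 + q * (a / b - 1))) +
   (b - a) * (b `^ q * (1 + q * (1 / b - 1))) by field; rewrite gt_eqF.
by rewrite mulr1 in h2; exact: lerD.
Qed.

(** The quotient of the two sides first increases and then decreases with [t],
    because the sign of its derivative is that of the convex function
    [1 + t - 2 t ^ (1 - p)], which vanishes at 1. *)
Lemma threshold_below p t t1 : 1 / 2 < p < 1 -> 0 < t -> t <= t1 -> t1 < 1 ->
  1 - t1 `^ p <= (1 - t1) `^ (2 * p) -> 1 - t `^ p <= (1 - t) `^ (2 * p).
Proof.
move=> /andP[p2 p1] t0 tt1 t11 end1.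
have p0 : 0 < p by lra.
pose psi x := 2 * p * ln (1 - x) - ln (1 - x `^ p).
have up x : 0 < x < 1 -> 0 < 1 - x `^ p.
  by move=> x01; rewrite subr_gt0 powR_lt1.
have psiE x : 0 < x < 1 -> (1 - x `^ p <= (1 - x) `^ (2 * p)) = (0 <= psi x).
  move=> x01; case/andP: (x01) => x0 x1; have v0 : 0 < 1 - x by lra.
  by rewrite -ler_ln ?posrE ?up ?powR_gt0// ln_powR subr_ge0.
have t10 := lt_le_trans t0 tt1; have tl1 := le_lt_trans tt1 t11.
have t01 : 0 < t < 1 by rewrite t0.
rewrite psiE//; rewrite psiE ?t10// in end1.
pose e x := 1 + x - 2 * x `^ (1 - p).
have D x : 0 < x < 1 ->
    has_deriv psi x (p * x `^ (p - 1) * e x / ((1 - x) * (1 - x `^ p))).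
  move=> x01; case/andP: (x01) => x0 x1; have v0 : 0 < 1 - x by lra.
  have w0 := up x x01; have xp := powR_gt0 p x0.
  apply: deriv_eq.
    apply: derivB.
      apply: derivZ; apply: deriv_ln; first exact: v0.
      by apply: derivB; [exact: deriv_cst | exact: deriv_id].
    apply: deriv_ln; first exact: w0.
    apply: derivB; first exact: deriv_cst.
    exact: is_derive1_powR.
  rewrite /e powR_subl1// powR_subr1//; field.
  by rewrite !gt_eqF.
have sgn x : 0 < x < 1 -> forall z, 0 <= e x * z ->
    0 <= p * x `^ (p - 1) * (e x * z) / ((1 - x) * (1 - x `^ p)).
  move=> x01 z ez; case/andP: (x01) => x0 x1; have v0 : 0 < 1 - x by lra.
  apply: divr_ge0; last by rewrite mulr_ge0 ?(ltW v0) ?(ltW (up x x01)).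
  by rewrite mulr_ge0// mulr_ge0 ?powR_ge0 ?(ltW p0).
have q01 : 0 <= 1 - p <= 1 by apply/andP; split; lra.
have eneg a b : 0 < a -> a <= b -> b < 1 -> (1 - a) * e b <= (1 - b) * e a.
  move=> a0 ab b1; have := powR_chord (1 - p) a b q01 a0 ab b1.
  by rewrite /e; lra.
(* Where [e] is nonnegative at [t] it is so on the left of [t], and [psi] starts
   from 0; otherwise [psi] decreases from [t] to [t1]. *)
have [et|et] := leP 0 (e t).
  pose dpsi x := p * x `^ (p - 1) * e x / ((1 - x) * (1 - x `^ p)).
  apply: (ge0_of_deriv psi dpsi (2 * p / (1 - t)) t t0) => x.
  - by move=> /andP[x0 xt]; apply: D; rewrite x0 (le_lt_trans xt).
  - move=> /andP[x0 xt]; have x1 := lt_trans xt tl1.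
    rewrite /dpsi -[e x]mulr1; apply: sgn; first by rewrite x0.
    have t1' : 0 < 1 - t by rewrite subr_gt0.
    rewrite mulr1 -(pmulr_rge0 _ t1'); apply: le_trans (eneg _ _ x0 (ltW xt) tl1).
    by rewrite mulr_ge0// subr_ge0 ltW.
  - move=> /andP[x0 xt]; have x1 := le_lt_trans xt tl1.
    have v0 : 0 < 1 - x by rewrite subr_gt0.
    have v1 : 0 < 1 - t by rewrite subr_gt0.
    have h1 : ln (1 - x `^ p) <= 0 by rewrite ln_le0// gerBl powR_ge0.
    have h2 : - (x / (1 - x)) <= ln (1 - x).
      rewrite lerNl -lnV ?posrE//.
      have -> : x / (1 - x) = (1 - x)^-1 - 1 by field; rewrite gt_eqF.
      by apply: ln_le_subr1; rewrite invr_gt0.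
    have h3 : x / (1 - x) <= x / (1 - t).
      by rewrite ler_pM2l// lef_pV2 ?posrE//; lra.
    have p20 : 0 <= 2 * p by lra.
    have : 2 * p * - (x / (1 - t)) <= 2 * p * ln (1 - x).
      by rewrite ler_wpM2l// (le_trans _ h2)// lerN2.
    have -> : 2 * p / (1 - t) * x = 2 * p * (x / (1 - t)) by ring.
    by rewrite /psi; lra.
rewrite (le_trans end1)// -lerN2.
rewrite -[X in X <= _]sub0r -[X in _ <= X]sub0r.
apply: (deriv_nondecr (fun x => 0 - psi x) _ _ tt1) => x /andP[tx xt1].
have x0 := lt_le_trans t0 tx; have x1 := le_lt_trans xt1 t11.
have x01 : 0 < x < 1 by rewrite x0.
eexists; first by apply: derivB; [exact: deriv_cst | exact: D].
have -> : 0 - p * x `^ (p - 1) * e x / ((1 - x) * (1 - x `^ p)) =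
  p * x `^ (p - 1) * (e x * -1) / ((1 - x) * (1 - x `^ p)) by ring.
apply: sgn => //; rewrite mulrN1 oppr_ge0.
have t1' : 0 < 1 - t by rewrite subr_gt0.
rewrite -(pmulr_rle0 _ t1'); apply: le_trans (eneg _ _ t0 tx x1) _.
by rewrite mulr_ge0_le0 ?subr_ge0 ?(ltW x1) ?(ltW et).
Qed.

End SmallT.

(** * Exponential estimates *)

Section Threshold.
Context {R : realType}.
Implicit Types (x y t p q a b w z e : R) (r s : nat).
Lemma expR_ge_taylor n x : 0 <= x ->
  \sum_(0 <= i < n) x ^+ i / i`!%:R <= expR x.
Proof.
move=> x0; apply: nondecreasing_cvgn_le; last exact: is_cvg_series_exp_coeff.
apply: nondecreasing_series => i _ _.
by rewrite divr_ge0// exprn_ge0.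
Qed.

(** This is [langevin_lower] solved for the exponential. *)
Lemma expR_sub1_le z : 0 < z -> z <= 38 / 100 ->
  expR (2 * z) - 1 <= 2 * z / (1 - z + 33 / 100 * z ^+ 2).
Proof.
move=> z0 z38; have := langevin_lower z (ltW z0).
have E0 : 0 < expR (2 * z) - 1 by rewrite subr_gt0 expR_gt1 mulr_gt0.
have e0 := expR_gt0 z; have ne0 := expR_gt0 (- z).
have -> : langevin z = 1 + 2 / (expR (2 * z) - 1) - z^-1.
  rewrite /langevin !unlock; congr (_ - _).
  have E2 : expR (2 * z) = expR z * expR z by rewrite -expRD; congr expR; ring.
  rewrite expRN E2; rewrite E2 in E0; move: E0 e0.
  set a := expR z => E0 e0.
  have E1 : a * a - 1 != 0 by rewrite gt_eqF.
  have E3 : a - a^-1 != 0.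
    have -> : a - a^-1 = (a * a - 1) / a by field; rewrite gt_eqF.
    by rewrite mulf_neq0 ?invr_eq0 ?gt_eqF.
  by field; rewrite E1 gt_eqF.
have D0 : 0 < 1 - z + 33 / 100 * z ^+ 2 by have := sqr_ge0 z; lra.
have z2 : 33 / 100 * z <= 5 * z / (15 + z ^+ 2).
  have D1 : 0 < 15 + z ^+ 2 by rewrite ltr_wpDr// sqr_ge0.
  rewrite ler_pdivlMr//.
  have : z * z ^+ 2 <= z * (38 / 100 * (38 / 100)).
    by rewrite ler_pM2l// expr2 ler_pM// ltW.
  by lra.
move=> h; rewrite ler_pdivlMr// mulrC -ler_pdivlMr//.
have -> : 2 * z / (expR (2 * z) - 1) = z * (2 / (expR (2 * z) - 1)) by ring.
have -> : 1 - z + 33 / 100 * z ^+ 2 = z * (z^-1 - 1 + 33 / 100 * z).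
  by field; rewrite gt_eqF.
by rewrite ler_pM2l//; lra.
Qed.

Lemma ln2_ge : 69 / 100 <= ln 2 :> R.
Proof.
rewrite -ler_expR lnK ?posrE//.
have z0 : 0 < 345 / 1000 :> R by lra.
have z38 : 345 / 1000 <= 38 / 100 :> R by lra.
have := expR_sub1_le (345 / 1000) z0 z38.
have -> : 2 * (345 / 1000) = 69 / 100 :> R by field.
have : 69 / 100 / (1 - 345 / 1000 + 33 / 100 * (345 / 1000) ^+ 2) <= 1 :> R.
  by rewrite ler_pdivrMr; lra.
by lra.
Qed.

Lemma ln2_le : ln 2 <= 1387 / 2000 :> R.
Proof.
rewrite -ler_expR lnK ?posrE//.
have h : 0 <= 1387 / 2000 :> R by lra.
apply: le_trans (expR_ge_taylor 6 _ h).
rewrite /index_iota unlock /= !factS fact0.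
by lra.
Qed.

Lemma bernoulli_powR q y : 1 <= q -> 0 <= y -> 1 + q * y <= (1 + y) `^ q.
Proof.
move=> q1 y0; have q0 : 0 < q by exact: lt_le_trans q1.
have y1 : 0 < 1 + y by lra.
have qy1 : 0 < 1 + q * y by rewrite ltr_wpDr ?mulr_ge0 ?(ltW q0).
rewrite -ler_ln ?posrE ?powR_gt0// ln_powR.
have i01 : 0 <= q^-1 <= 1 by rewrite invr_ge0 (ltW q0) invf_le1.
have := ln_bernoulli q^-1 (1 + q * y) i01 qy1.
have -> : 1 + q^-1 * (1 + q * y - 1) = 1 + y by field; rewrite gt_eqF.
by rewrite -(ler_pM2l q0) mulrA mulfV ?gt_eqF// mul1r.
Qed.

Lemma four_powR_ge e : 0 <= e ->
  1 + 69 / 50 * e + (69 / 50 * e) ^+ 2 / 2 + (69 / 50 * e) ^+ 3 / 6 <= 4 `^ e.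
Proof.
move=> e0; have -> : 4 `^ e = expR (e * ln 4).
  by rewrite /powR gt_eqF.
have l4 : 69 / 50 <= ln 4 :> R.
  have -> : 4 = 2 ^+ 2 :> R by ring.
  by rewrite lnXn// -mulr_natl; have := ln2_ge; lra.
apply: (@le_trans _ _ (expR (69 / 50 * e))); last first.
  by rewrite ler_expR (mulrC e) ler_wpM2r.
have h : 0 <= 69 / 50 * e by rewrite mulr_ge0.
apply: le_trans (expR_ge_taylor 4 _ h).
rewrite !big_nat_recr//= big_geq// !factS fact0.
move: (69 / 50 * e) => y; by lra.
Qed.

(** Here [w = 1 / (r + 2)] and [e = 2 p - 1]. For fixed [e] the difference of the
    two sides decreases in [w], so that it is enough to treat the largest [w]
    allowed by the constraints, [4 e / (7 + e)] or [1 / 5]; what remains is a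
    polynomial in [e] with a nonnegative Bernstein expansion. *)
Lemma threshold_poly w e : 0 < w -> w <= 1 / 5 -> e <= 1 / 2 ->
  7 * w <= e * (4 - w) ->
  (1 + e) * (1 - w / 2) <=
  (1 + 69 / 50 * e + (69 / 50 * e) ^+ 2 / 2 + (69 / 50 * e) ^+ 3 / 6) *
  (1 - (1 + e) * w + 33 / 100 * ((1 + e) * w) ^+ 2).
Proof.
move=> w0 w5 e2 we.
have e0 : 0 < e by nra.
set E := _ + _ / 6.
have E1 : 1 <= E.
  have h : 0 <= 69 / 50 * e by lra.
  have := exprn_ge0 2 h; have := exprn_ge0 3 h; rewrite /E; lra.
pose D v := E * (1 - (1 + e) * v + 33 / 100 * ((1 + e) * v) ^+ 2)
            - (1 + e) * (1 - v / 2).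
have mono v : w <= v -> v <= 1 / 5 -> 0 <= D v -> 0 <= D w.
  move=> wv v5 Dv; suff : 0 <= D w - D v by lra.
  have -> : D w - D v =
    (v - w) * ((1 + e) * (E * (1 - 33 / 100 * ((1 + e) * (w + v))) - 1 / 2)).
    by rewrite /D; field.
  apply: mulr_ge0; first by rewrite subr_ge0.
  apply: mulr_ge0; first by lra.
  have h : (1 + e) * (w + v) <= 3 / 2 * (2 / 5) by apply: ler_pM; lra.
  have : 1 / 2 <= E * (1 - 33 / 100 * ((1 + e) * (w + v))).
    apply: (@le_trans _ _ (1 * (1 / 2))); first by lra.
    by apply: ler_pM => //; lra.
  by lra.
suff : 0 <= D w by rewrite subr_ge0.
have [eb|eb] := leP e (7 / 19).
  pose v := 4 * e / (7 + e).
  have d0 : 0 < 7 + e by lra.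
  apply: (mono v).
  - by rewrite /v ler_pdivlMr//; lra.
  - by rewrite /v ler_pdivrMr//; lra.
  have -> : D v = (E * ((7 + e) ^+ 2 - (1 + e) * (4 * e) * (7 + e)
      + 33 / 100 * ((1 + e) * (4 * e)) ^+ 2)
      - (1 + e) * (7 + e) * (7 + e - 2 * e)) / (7 + e) ^+ 2.
    by rewrite /D /v; field; rewrite gt_eqF.
  apply: divr_ge0; last exact: sqr_ge0.
  pose u := 19 / 7 * e.
  have u01 : 0 <= u <= 1 by rewrite /u; apply/andP; split; lra.
  have eE : e = 7 / 19 * u by rewrite /u; field.
  have H := bernstein_ge0 0 u (lexx _) u01.
  rewrite /E eE.
  move: (H 0 0 7)%N (H 0 1 6)%N (H 0 2 5)%N (H 0 3 4)%N (H 0 4 3)%N (H 0 5 2)%N (H 0 6 1)%N (H 0 7 0)%N.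
  by lra.
apply: (mono (1 / 5)) => //.
pose u := (e - 7 / 19) / (1 / 2 - 7 / 19).
have d0 : 0 < 1 / 2 - 7 / 19 :> R by lra.
have u01 : 0 <= u <= 1.
  by rewrite /u ler_pdivlMr// ler_pdivrMr//; apply/andP; split; lra.
have eE : e = 7 / 19 + (1 / 2 - 7 / 19) * u by rewrite /u; field; lra.
have H := bernstein_ge0 0 u (lexx _) u01.
rewrite /D /E eE.
move: (H 0 0 5)%N (H 0 1 4)%N (H 0 2 3)%N (H 0 3 2)%N (H 0 4 1)%N (H 0 5 0)%N.
by lra.
Qed.

End Threshold.

(** * Admissible exponents *)

Section AdmissibleMin.
Context {R : realType}.
Implicit Types (x y t p q a b w z e m : R) (r s u : nat).

Definition below_quot r p := forall u, (r <= u)%N ->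
  p * (ln r.+1%:R + ln u.+1%:R) <= ln (r + u).+1%:R :> R.

(** For [s <= v = p r / (1 - p)] admissibility comes from the sign of the drift;
    for larger [s] it is inherited from [floor v] by the tangent-line step. *)
Lemma admissible_at_near_one r s p b : 0 < p < 1 -> 0 < b -> (r <= s)%N ->
  below_quot r p -> (1 - p) * r%:R <= p * r%:R ->
  (forall u x, (r <= u)%N -> (1 - p) * u%:R <= p * r%:R -> 0 < x < b ->
     0 <= drift r.+1%:R u.+1%:R (r + u).+1%:R p x) ->
  (forall n x, p * r%:R <= (1 - p) * n -> 0 < x < b ->
     r.+1%:R * langevin (r.+1%:R * x) <=
     r%:R * langevin (n * x) + 2 * langevin x - langevin (p * x)) ->
  geomG r (expR (- (2 * b))) `^ p * geomG s (expR (- (2 * b))) `^ p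
    <= geomG (r + s) (expR (- (2 * b)) `^ p).
Proof.
move=> p01 b0 rs bq rp dr sl; case/andP: (p01) => p0 p1.
have q0 : 0 < 1 - p by rewrite subr_gt0.
have at_small u : (r <= u)%N -> (1 - p) * u%:R <= p * r%:R ->
    geomG r (expR (- (2 * b))) `^ p * geomG u (expR (- (2 * b))) `^ p
    <= geomG (r + u) (expR (- (2 * b)) `^ p).
  move=> ru uv; apply: admissible_at_of_drift => //; first exact: bq.
  by move=> x xb; exact: dr.
have [sv|vs] := leP ((1 - p) * s%:R) (p * r%:R); first exact: at_small.
pose v := p * r%:R / (1 - p).
have v0 : 0 <= v by rewrite divr_ge0 ?mulr_ge0 ?(ltW p0) ?(ltW q0).
(* the integer from which the inequality is inherited *)
pose s0 := Num.trunc v.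
have /andP[s0v vs0] : s0%:R <= v < s0.+1%:R by exact: truncn_itv.
have s0v' : (1 - p) * s0%:R <= p * r%:R by rewrite mulrC -ler_pdivlMr.
have vs0' : p * r%:R <= (1 - p) * s0.+1%:R.
  by rewrite (mulrC (1 - p)) -ler_pdivrMr// ltW.
have rs0 : (r <= s0)%N.
  have : r%:R < s0.+1%:R :> R by apply: le_lt_trans vs0; rewrite ler_pdivlMr// mulrC.
  by rewrite ltr_nat ltnS.
have s0s : (s0 <= s)%N.
  have : (1 - p) * s0%:R < (1 - p) * s%:R by exact: le_lt_trans vs.
  by rewrite ltr_pM2l// ltr_nat => /ltnW.
have t01 := exp2_in01 b b0.
apply: (admissible_at_mono r s0 s _ p t01 p01 s0s); last exact: at_small.
apply: (slope_of_langevin r s0 p b) => //; last by move=> x; exact: sl.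
have n0 : 0 < s0.+1%:R :> R by rewrite ltr0n.
have N0 : 0 < (r + s0).+1%:R :> R by rewrite ltr0n.
have pN : p * (r + s0).+1%:R <= s0.+1%:R.
  by rewrite -addnS natrD; move: vs0'; lra.
have : ln (p * (r + s0).+1%:R) <= ln (s0.+1%:R : R).
  by rewrite ler_ln ?posrE ?mulr_gt0.
by rewrite lnM ?posrE//; have := bq s0 rs0; lra.
Qed.

Lemma exp2_of_lt1 t : 0 < t < 1 -> exists2 x, 0 < x & t = expR (- (2 * x)).
Proof.
move=> /andP[t0 t1]; exists (- ln t / 2).
  by rewrite divr_gt0// oppr_gt0 ln_lt0// t0.
have -> : - (2 * (- ln t / 2)) = ln t by field.
by rewrite lnK ?posrE.
Qed.

(** The two extreme values [t = 0] and [t = 1] are separate: both sides are 1 at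
    the former, and the latter is the definition of [below_quot]. *)
Lemma admissible_of_thresholds r s p t1 : 0 < p < 1 -> (r <= s)%N ->
  below_quot r p -> (1 - p) * r.+1%:R <= p * r%:R ->
  (forall t, 0 < t -> t <= t1 -> t < 1 ->
     (1 - t `^ p) * geomG r t `^ (2 * p - 1) <= 1 - t) ->
  (forall b, 0 < b -> t1 < expR (- (2 * b)) ->
     geomG r (expR (- (2 * b))) `^ p * geomG s (expR (- (2 * b))) `^ p
     <= geomG (r + s) (expR (- (2 * b)) `^ p)) ->
  admissible r s p.
Proof.
move=> p01 rs bq rp small near; case/andP: (p01) => p0 p1; right; split => // t.
rewrite le_eqVlt => /predU1P[<- _|t0].
  by rewrite powR0 ?gt_eqF// !geomG0 powR1 mulr1.
rewrite le_eqVlt => /predU1P[->|t1'].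
  rewrite powR1 !geomG1 -ler_ln ?posrE ?mulr_gt0 ?powR_gt0 ?ltr0n//.
  by rewrite lnM ?posrE ?powR_gt0 ?ltr0n// !ln_powR -mulrDr; exact: bq.
have t01 : 0 < t < 1 by rewrite t0.
have [tt1|t1t] := leP t t1.
  by apply: admissible_at_small => //; [rewrite addn1 | exact: small].
have [b b0 tE] := exp2_of_lt1 t t01.
by move: t1t; rewrite tE; exact: near.
Qed.

(** The minimum of the first row is attained at [s = 2], close to [24 / 31]. The
    bounds give [v < 4], so that only [s = 1, 2, 3] need the sign of the drift. *)
Lemma admissible_row_one s p : 17 / 22 <= p -> p <= 24 / 31 -> (1 <= s)%N ->
  below_quot 1 p -> admissible 1 s p.
Proof.
move=> plow pup s1 bq.
have p01 : 0 < p < 1 by apply/andP; split; lra.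
have pup' : p <= 7 / 9 by lra.
(* [t > 1 / 4] means [x < ln 2], and [(1387 / 2000) ^ 2 < 481 / 1000] *)
apply: (admissible_of_thresholds 1 s p (1 / 4)) => //; first by lra.
  by move=> t t0 t4 _; apply: small_t_one; rewrite ?t0//; lra.
move=> b b0 tb.
have bX x : 0 < x < b -> x ^+ 2 <= 481 / 1000.
  move=> /andP[x0 xb].
  have b2 : b <= ln 2.
    move: tb; rewrite -ltr_ln ?posrE ?expR_gt0// expRK div1r lnV ?posrE//.
    have -> : 4 = 2 ^+ 2 :> R by ring.
    by rewrite lnXn// -mulr_natl; lra.
  have x2 : x <= 1387 / 2000.
    by apply: le_trans ln2_le; exact: le_trans (ltW xb) b2.
  rewrite expr2; apply: (@le_trans _ _ (1387 / 2000 * (1387 / 2000))); last by lra.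
  by apply: ler_pM => //; exact: ltW.
apply: admissible_at_near_one => //; first by lra.
- move=> u x u1 uv xb; have X := bX x xb; case/andP: xb => x0 xb.
  have : (u < 4)%N.
    rewrite -(ltr_nat R); have : (1 - 7 / 9) * u%:R <= 7 / 9 :> R.
      apply: (@le_trans _ _ ((1 - p) * u%:R)); first by rewrite ler_wpM2r//; lra.
      by apply: le_trans uv _; lra.
    by lra.
  move: u1; case: u uv => // -[|[|[|//]]] _ _ _.
  + exact: drift_one_one_ge0.
  + exact: drift_one_two_ge0.
  + exact: drift_one_three_ge0.
move=> n x nv xb; have X := bX x xb; case/andP: xb => x0 xb.
have nv' : 17 / 5 <= n.
  rewrite leNgt; apply/negP => n34.
  have : (1 - p) * n < (1 - p) * (17 / 5) by rewrite ltr_pM2l//; lra.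
  by lra.
have e9 : 0 <= 9 / 374 :> R by lra.
have := drift_far_one p x plow pup' x0 X n 0 nv'.
by rewrite lexx subr0 mul1r => /(_ e9).
Qed.

(** The two powers are bounded below at the largest exponent [18 / 25], by
    rational numbers with sum 1. *)
Lemma threshold_two p : 1 / 2 < p -> p <= 18 / 25 ->
  1 - (3 / 8) `^ p <= (1 - 3 / 8) `^ (2 * p).
Proof.
move=> p2 p18.
have G a c : 0 < a <= 1 -> 0 < c -> c ^+ 25 <= a ^+ 18 -> c <= a `^ p.
  move=> /andP[a0 a1] c0 ca; apply: (@le_trans _ _ (a `^ (18 / 25))); last first.
    by apply: ger_powR => //; rewrite a0.
  rewrite -(@ler_pXn2r _ 25)// ?nnegrE ?powR_ge0 ?(ltW c0)//.
  rewrite -[leRHS]powR_mulrn ?powR_ge0// -powRrM divfK ?pnatr_eq0//.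
  by rewrite powR_mulrn// ltW.
have h1 : 197 / 400 <= (3 / 8) `^ p :> R.
  by apply: G; [apply/andP; split; lra | lra | lra].
have h2 : 203 / 400 <= (25 / 64) `^ p :> R.
  by apply: G; [apply/andP; split; lra | lra | lra].
rewrite powRrM.
have -> : (1 - 3 / 8) `^ 2 = 25 / 64 :> R.
  rewrite (_ : 1 - 3 / 8 = 5 / 8); last by field.
  by rewrite powR_mulrn//; field.
by lra.
Qed.

(** Since [(m + 1) ^ 2 = m (m + 2) + 1], the hypothesis nearly bounds the power of
    [(m + 1) ^ 2]; the second factor is the Bernoulli correction. *)
Lemma square_powR_le m p : 1 <= m -> 0 <= p <= 1 ->
  p * (ln m + ln (m + 2)) <= ln (2 * m + 1) ->
  ((m + 1) ^+ 2) `^ p <= (2 * m + 1) * (1 + p * (4 / (3 * (m + 1) ^+ 2))).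
Proof.
move=> m1' p01 pup; have m0 : 0 < m by lra.
have m2 : 0 < m + 2 by lra.
have m1 : 0 < m * (m + 2) by rewrite mulr_gt0.
have h : 0 < 2 * m + 1 by lra.
have mp : (m * (m + 2)) `^ p <= 2 * m + 1.
  by rewrite -ler_ln ?posrE ?powR_gt0// ln_powR lnM ?posrE.
have E : (m + 1) ^+ 2 = m * (m + 2) * (1 + (m * (m + 2))^-1).
  by rewrite mulrDr mulfV ?gt_eqF//; ring.
have k0 : 0 < (m * (m + 2))^-1 by rewrite invr_gt0.
have k1 : 0 < 1 + (m * (m + 2))^-1 by rewrite addr_gt0.
rewrite [in leLHS]E powRM ?(ltW m1) ?(ltW k1)//.
apply: ler_pM; rewrite ?powR_ge0//.
apply: le_trans (powR_bernoulli p _ p01 k1) _.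
rewrite lerD2l (addrAC 1) subrr add0r ler_wpM2l//; first by case/andP: p01.
have m10 : 0 < 3 * (m + 1) ^+ 2 by rewrite mulr_gt0// exprn_gt0//; lra.
rewrite ler_pdivlMr// mulrC ler_pdivrMr// -subr_ge0.
have -> : 4 * (m * (m + 2)) - 3 * (m + 1) ^+ 2 = m ^+ 2 - 3 + 2 * m by ring.
by have := exprn_ege1 2 m1'; lra.
Qed.

(** With [x = 2 / (m + 1)], the power of [2 x] is evaluated by [square_powR_le];
    the cubic term in the lower bound for [sinh] compensates its correction
    factor exactly. *)
Lemma sinh_powR_ge m p : 4 <= m -> 1 / 2 < p -> p <= 3 / 4 ->
  p * (ln m + ln (m + 2)) <= ln (2 * m + 1) ->
  4 * 4 `^ (2 * p - 1) / (2 * m + 1) <= (2 * sinh (2 / (m + 1))) `^ (2 * p).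
Proof.
move=> m4 p2 p34 pup; have m0 : 0 < m by lra.
have M0 : 0 < m + 1 by lra.
have h : 0 < 2 * m + 1 by lra.
have p0 : 0 < p by lra.
have p20 : 0 <= 2 * p by lra.
have p21 : 1 <= 2 * p by lra.
have p01 : 0 <= p <= 1 by apply/andP; split; lra.
have m1 : 1 <= m by lra.
have := square_powR_le m p m1 p01 pup; move: M0.
set M := m + 1 => M0 MMp.
pose x := 2 / M; have x0 : 0 < x by rewrite divr_gt0.
have MM : 0 < M ^+ 2 by rewrite exprn_gt0.
have Mp0 : 0 < (M ^+ 2) `^ p by rewrite powR_gt0.
have tx0 : 0 <= 2 * x by rewrite mulr_ge0// ltW.
have y0 : 0 <= x ^+ 2 / 6 by rewrite divr_ge0// sqr_ge0.
have y1 : 0 <= 1 + x ^+ 2 / 6 by rewrite addr_ge0.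
have c0 : 0 <= 2 * x * (1 + x ^+ 2 / 6) by rewrite mulr_ge0.
have sx : 2 * x * (1 + x ^+ 2 / 6) <= 2 * sinh x.
  by rewrite -mulrA ler_pM2l// sinh_ge_cubic// ltW.
apply: (@le_trans _ _ ((2 * x * (1 + x ^+ 2 / 6)) `^ (2 * p))); last first.
  by apply: ge0_ler_powR => //; rewrite nnegrE// (le_trans c0).
rewrite (powRM _ tx0 y1).
apply: le_trans (ler_wpM2l (powR_ge0 _ _) (bernoulli_powR _ _ p21 y0)).
have -> : (2 * x) `^ (2 * p) = 4 * 4 `^ (2 * p - 1) / (M ^+ 2) `^ p.
  rewrite powRrM powR_mulrn//.
  have -> : (2 * x) ^+ 2 = 4 ^+ 2 * (M ^+ 2)^-1 by rewrite /x; field; rewrite gt_eqF.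
  have iM : 0 <= (M ^+ 2)^-1 by rewrite invr_ge0 sqr_ge0.
  have i4 : 0 <= 4 ^+ 2 :> R by exact: sqr_ge0.
  rewrite (powRM _ i4 iM) powR_inv//; congr (_ * _).
  by rewrite -powR_mulrn// -powRrM powR_subl1//; field.
rewrite -[leRHS]mulrA; apply: ler_wpM2l; first by rewrite mulr_ge0 ?powR_ge0.
rewrite ler_pdivlMl// ler_pdivrMr// mulrC; apply: le_trans MMp _.
rewrite ler_pM2l// lerD2l le_eqVlt; apply/orP; left; apply/eqP.
by rewrite /x; field; rewrite gt_eqF.
Qed.

(** After division by [t ^ p], the inequality compares
    [exp (2 p x) - 1] with [(2 sinh x) ^ (2 p)] for [x = 2 / (m + 1)]. *)
Lemma threshold_large m p t : 4 <= m -> p <= 3 / 4 -> 2 * m + 5 <= (4 * m + 3) * p ->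
  p * (ln m + ln (m + 2)) <= ln (2 * m + 1) ->
  t = expR (- (2 * (2 / (m + 1)))) -> 1 - t `^ p <= (1 - t) `^ (2 * p).
Proof.
move=> m4 p34 plow pup tE; pose M := m + 1; pose x := 2 / M.
have p2 : 1 / 2 < p.
  rewrite ltNge; apply/negP => p2.
  have : (4 * m + 3) * p <= (4 * m + 3) * (1 / 2) by rewrite ler_wpM2l//; lra.
  by lra.
have := sinh_powR_ge m p m4 p2 p34 pup; rewrite -/M -/x => sx; clear pup.
have M0 : 0 < M by rewrite /M; lra.
have x0 : 0 < x by rewrite divr_gt0.
have p0 : 0 < p by lra.
pose w := M^-1; pose e := 2 * p - 1; pose z := (1 + e) * w.
have w0 : 0 < w by rewrite invr_gt0.
have w5 : w <= 1 / 5.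
  by rewrite /w div1r lef_pV2 ?posrE// /M; lra.
have zE : z = p * x by rewrite /z /e /w /x; field; rewrite gt_eqF.
have we : 7 * w <= e * (4 - w).
  have : 7 * w <= w * (e * (4 * M - 1)).
    by rewrite mulrC ler_pM2l// /e /M; lra.
  have -> : w * (e * (4 * M - 1)) = e * (4 - w).
    by rewrite /w; field; rewrite gt_eqF.
  by [].
have e2 : e <= 1 / 2 by rewrite /e; lra.
have e0 : 0 <= e by rewrite /e; lra.
have := threshold_poly w e w0 w5 e2 we; rewrite -/z.
have := four_powR_ge e e0; set E := _ + _ / 6 => E4 poly.
have z0 : 0 < z by rewrite zE mulr_gt0.
have z38 : z <= 38 / 100.
  rewrite /z; apply: (@le_trans _ _ (3 / 2 * (1 / 5))); last by lra.
  by apply: ler_pM => //; [rewrite addr_ge0 | exact: ltW | clear - e2; lra].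
have D0 : 0 < 1 - z + 33 / 100 * z ^+ 2.
  by have := sqr_ge0 z; clear - z38; lra.
(* both sides are multiplied by [exp (2 p x)] *)
suff main : expR (2 * z) - 1 <= (2 * sinh x) `^ (2 * p).
  rewrite -/M -/x in tE.
  have -> : 1 - t `^ p = (expR (2 * z) - 1) * expR (- (2 * z)).
    rewrite mulrBl mul1r -expRD subrr expR0; congr (_ - _).
    by rewrite tE powR_expR zE; congr expR; ring.
  have -> : (1 - t) `^ (2 * p) = (2 * sinh x) `^ (2 * p) * expR (- (2 * z)).
    have sx0 : 0 <= 2 * sinh x by rewrite mulr_ge0// sinh_ge0// ltW.
    rewrite tE one_sub_expE mulrAC (powRM _ sx0 (expR_ge0 _)).
    by rewrite powR_expR zE; congr (_ * expR _); ring.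
  by rewrite ler_pM2r ?expR_gt0.
apply: le_trans (expR_sub1_le z z0 z38) _; apply: le_trans sx.
have h : 0 < 2 * m + 1 by clear - m4; lra.
rewrite ler_pdivlMr// mulrAC ler_pdivrMr//.
have -> : 2 * z * (2 * m + 1) = 4 * ((1 + e) * (1 - w / 2)).
  have -> : 2 * m + 1 = 2 * M - 1 by rewrite /M; ring.
  by rewrite /z /w; field; rewrite gt_eqF.
rewrite -[leRHS]mulrA ler_pM2l//; apply: le_trans poly _.
by rewrite ler_wpM2r// ltW.
Qed.

(** The two ranges of [t] overlap when the threshold [t1 = exp (- 2 b)] satisfies
    [(r + 2) b <= 2], the range in which the sign of the drift is known. *)
Lemma admissible_row_large r s p t1 : (2 <= r)%N -> (r <= s)%N -> p <= 3 / 4 ->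
  r.+1%:R + 2 <= (2 * r.+1%:R + 1) * p -> below_quot r p ->
  0 < t1 < 1 -> 1 - t1 `^ p <= (1 - t1) `^ (2 * p) ->
  (forall b, t1 < expR (- (2 * b)) -> (r.+1%:R + 1) * b <= 2) ->
  admissible r s p.
Proof.
move=> r2 rs p34 plow bq /andP[t10 t11] psi tb.
have m3 : 3 <= r.+1%:R :> R by rewrite ler_nat.
have rE : r%:R = r.+1%:R - 1 :> R by rewrite -natr1 addrK.
have p2 : 1 / 2 < p.
  rewrite ltNge; apply/negP => p2.
  have : (2 * r.+1%:R + 1) * p <= (2 * r.+1%:R + 1) * (1 / 2).
    by rewrite ler_wpM2l//; lra.
  by lra.
have p0 : 0 < p by lra.
have p01 : 0 < p < 1 by apply/andP; split; lra.
have rv : (1 - p) * (r.+1%:R + 2) <= p * r%:R by rewrite rE; lra.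
have q0 : 0 < 1 - p by lra.
have rp : (1 - p) * r.+1%:R <= p * r%:R.
  by apply: le_trans rv; rewrite ler_pM2l//; lra.
apply: (admissible_of_thresholds r s p t1) => //.
  move=> t t0 tt1 t_1; apply: small_t_of_threshold => //; first by rewrite t0.
  by apply: (threshold_below p t t1) => //; rewrite p2; lra.
move=> b b0 t1b.
have mb x : 0 < x < b -> (r.+1%:R + 1) * x <= 2.
  move=> /andP[x0 xb]; apply: le_trans (tb b t1b).
  by rewrite ler_pM2l ?(ltW xb)//; lra.
apply: admissible_at_near_one => //.
- by apply: le_trans rp; rewrite ler_pM2l// rE; lra.
- move=> u x ru uv xb; have mx := mb x xb; case/andP: xb => x0 _.
  exact: drift_ge0_large.
move=> n x nv xb; have mx := mb x xb; case/andP: xb => x0 _.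
have mn : r.+1%:R + 2 <= n.
  rewrite -(ler_pM2l q0); exact: le_trans rv nv.
have e0 : 0 * (r.+1%:R + 2) <= 1 / 2 :> R by rewrite mul0r; lra.
have := drift_far p r.+1%:R x m3 p34 plow x0 mx n 0 mn (lexx _) e0.
by rewrite subr0 rE.
Qed.

End AdmissibleMin.

(** * The real-variable quotient *)

Section Quotient.
Context {R : realType}.
Implicit Types (x y t p q a b c m : R) (r s u : nat).

Definition log_quot (r x : R) : R := ln (r + x + 1) / (ln (r + 1) + ln (x + 1)).

(** This is the derivative of [log_quot r] at [x] up to a positive factor. *)
Definition excess (r x : R) : R :=
  (x + 1) * (ln (r + 1) + ln (x + 1)) - (r + x + 1) * ln (r + x + 1).

(** The mean of [(y + 1) / (x + 1)] and 1 with weights proportional to [x + 1] and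
    [r] is [(r + y + 1) / (r + x + 1)]; this is concavity of the logarithm. *)
Lemma ln_shift (r x y : R) : 0 <= r -> 0 <= x -> 0 <= y ->
  (x + 1) * (ln (y + 1) - ln (x + 1)) <=
  (r + x + 1) * (ln (r + y + 1) - ln (r + x + 1)).
Proof.
move=> r0 x0 y0.
have x1 : 0 < x + 1 by lra.
have y1 : 0 < y + 1 by lra.
have N0 : 0 < r + x + 1 by lra.
have N1 : 0 < r + y + 1 by lra.
have p01 : 0 <= (x + 1) / (r + x + 1) <= 1.
  by rewrite divr_ge0 ?(ltW x1) ?(ltW N0)//= ler_pdivrMr//; lra.
have := ln_bernoulli _ _ p01 (divr_gt0 y1 x1).
have -> : 1 + (x + 1) / (r + x + 1) * ((y + 1) / (x + 1) - 1) =
  (r + y + 1) / (r + x + 1) by field; rewrite (gt_eqF x1) (gt_eqF N0).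
rewrite !ln_div ?posrE// -(ler_pM2l N0).
by rewrite mulrA (mulrCA (r + x + 1)) mulfV ?gt_eqF// mulr1.
Qed.

Lemma log_den_gt0 (r x : R) : 0 < r -> 0 <= x -> 0 < ln (r + 1) + ln (x + 1).
Proof. by move=> r0 x0; rewrite ltr_wpDr ?ln_ge0 ?ln_gt0//; lra. Qed.

(** At every [y], [ln_shift] bounds the numerator of [log_quot r y] below by
    [(x + 1) / (r + x + 1)] times its denominator, plus a multiple of
    [- excess r x]. *)
Lemma log_quot_ge_ratio (r x y : R) : 0 < r -> 0 <= x -> 0 <= y ->
  excess r x <= 0 -> (x + 1) / (r + x + 1) <= log_quot r y.
Proof.
move=> r0 x0 y0; rewrite subr_le0 => ex.
have N0 : 0 < r + x + 1 by lra.
rewrite /log_quot ler_pdivlMr ?log_den_gt0// mulrAC ler_pdivrMr//.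
by have := ln_shift r x y (ltW r0) x0 y0; lra.
Qed.

Lemma log_quot_ratio (r x : R) : 0 < r -> 0 <= x -> excess r x = 0 ->
  log_quot r x = (x + 1) / (r + x + 1).
Proof.
move=> r0 x0 /eqP; rewrite subr_eq0 => /eqP ex.
have N0 : 0 < r + x + 1 by lra.
have D0 := log_den_gt0 r x r0 x0.
have x1 : 0 < x + 1 by lra.
rewrite /log_quot; have -> : ln (r + x + 1) =
    (x + 1) / (r + x + 1) * (ln (r + 1) + ln (x + 1)).
  by rewrite mulrAC ex mulrAC mulfV ?mul1r// gt_eqF.
by rewrite mulfK// gt_eqF.
Qed.

(** From [x] to [y] the numerator loses at most [(x + 1) / (r + x + 1)] times what
    the denominator loses, and that ratio is at most [log_quot r x]. *)
Lemma log_quot_decr (r x y : R) : 0 < r -> 0 <= y -> y <= x ->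
  excess r x <= 0 -> log_quot r x <= log_quot r y.
Proof.
move=> r0 y0 yx ex; have x0 := le_trans y0 yx.
have N0 : 0 < r + x + 1 by lra.
have Dx := log_den_gt0 r x r0 x0; have Dy := log_den_gt0 r y r0 y0.
have x1 : 0 < x + 1 by lra.
have y1 : 0 < y + 1 by lra.
have th := log_quot_ge_ratio r x x r0 x0 x0 ex.
rewrite [leRHS]/log_quot ler_pdivlMr//.
have E : ln (r + x + 1) = log_quot r x * (ln (r + 1) + ln (x + 1)).
  by rewrite /log_quot divfK// gt_eqF.
have lw : ln (y + 1) - ln (x + 1) <= 0 by rewrite subr_le0 ler_ln ?posrE//; lra.
have h1 := ln_shift r x y (ltW r0) x0 y0.
have h2 : (x + 1) / (r + x + 1) * (ln (y + 1) - ln (x + 1)) <=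
          ln (r + y + 1) - ln (r + x + 1).
  by rewrite mulrAC ler_pdivrMr// (mulrC _ (r + x + 1)).
have h3 : log_quot r x * (ln (y + 1) - ln (x + 1)) <=
          (x + 1) / (r + x + 1) * (ln (y + 1) - ln (x + 1)).
  by rewrite ler_wnM2r.
by move: h2 h3 E; lra.
Qed.

Lemma log_quot_incr (r x y : R) : 0 < r -> 0 <= x -> x <= y ->
  0 <= excess r x -> log_quot r x <= log_quot r y.
Proof.
move=> r0 x0 xy; rewrite subr_ge0 => ex; have y0 := le_trans x0 xy.
have N0 : 0 < r + x + 1 by lra.
have Dx := log_den_gt0 r x r0 x0; have Dy := log_den_gt0 r y r0 y0.
have x1 : 0 < x + 1 by lra.
have y1 : 0 < y + 1 by lra.
have th : log_quot r x <= (x + 1) / (r + x + 1).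
  by rewrite /log_quot ler_pdivrMr// mulrAC ler_pdivlMr// mulrC.
rewrite [leRHS]/log_quot ler_pdivlMr//.
have E : ln (r + x + 1) = log_quot r x * (ln (r + 1) + ln (x + 1)).
  by rewrite /log_quot divfK// gt_eqF.
have lw : 0 <= ln (y + 1) - ln (x + 1) by rewrite subr_ge0 ler_ln ?posrE//; lra.
have h1 := ln_shift r x y (ltW r0) x0 y0.
have h2 : (x + 1) / (r + x + 1) * (ln (y + 1) - ln (x + 1)) <=
          ln (r + y + 1) - ln (r + x + 1).
  by rewrite mulrAC ler_pdivrMr// (mulrC _ (r + x + 1)).
have h3 : log_quot r x * (ln (y + 1) - ln (x + 1)) <=
          (x + 1) / (r + x + 1) * (ln (y + 1) - ln (x + 1)).
  by rewrite ler_wpM2r.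
by move: h2 h3 E; lra.
Qed.

Lemma deriv_excess (r x : R) : 0 <= r -> 0 <= x ->
  has_deriv (excess r) x (ln (r + 1) + ln (x + 1) - ln (r + x + 1)).
Proof.
move=> r0 x0.
have x1 : 0 < x + 1 by lra.
have N0 : 0 < r + x + 1 by lra.
have dx1 : has_deriv (fun y => y + 1) x 1.
  apply: deriv_eq; first by apply: derivD; [exact: deriv_id | exact: deriv_cst].
  by rewrite addr0.
have dN : has_deriv (fun y => r + y + 1) x 1.
  apply: deriv_eq.
    apply: derivD; last exact: deriv_cst.
    by apply: derivD; [exact: deriv_cst | exact: deriv_id].
  by rewrite addr0 add0r.
apply: deriv_eq.
  apply: derivB.
    apply: derivM; first exact: dx1.
    by apply: derivD; [exact: deriv_cst | apply: deriv_ln dx1].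
  by apply: derivM; [exact: dN | apply: deriv_ln dN].
by rewrite /=; field; rewrite (gt_eqF x1) (gt_eqF N0).
Qed.

Lemma excess_deriv_gt0 (r x : R) : 0 < r -> 0 < x ->
  0 < ln (r + 1) + ln (x + 1) - ln (r + x + 1).
Proof.
move=> r0 x0; rewrite -lnM ?posrE; [|lra..].
have rx : 0 < r * x by rewrite mulr_gt0.
rewrite subr_gt0 ltr_ln ?posrE; [|lra|rewrite mulr_gt0//; lra].
by rewrite mulrDl !mulrDr; lra.
Qed.

(** The derivative [ln ((r + 1) (x + 1) / (r + x + 1))] is positive. *)
Lemma excess_lt (r x y : R) : 0 < r -> 0 <= x -> x < y -> excess r x < excess r y.
Proof.
move=> r0 x0 xy; pose z := (x + y) / 2.
have xz : x <= z by rewrite /z; lra.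
have zy : z <= y by rewrite /z; lra.
have z0 : 0 < z by rewrite /z; lra.
have mono a b : 0 <= a -> a <= b -> excess r a <= excess r b.
  move=> a0 ab.
  apply: (deriv_nondecr (excess r) a b ab) => w /andP[aw _].
  have w0 := le_trans a0 aw; eexists; first by apply: deriv_excess => //; exact: ltW.
  move: w0; rewrite le_eqVlt => /predU1P[<-|w0].
    by rewrite add0r addr0 ln1 addr0 subrr.
  by rewrite ltW// excess_deriv_gt0.
apply: le_lt_trans (mono x z x0 xz) _.
pose d := ln (r + 1) + ln (z + 1) - ln (r + z + 1).
have d0 : 0 < d by exact: excess_deriv_gt0.
have : excess r z - d * z <= excess r y - d * y.
  apply: (deriv_nondecr (fun w => excess r w - d * w) z y zy) => w /andP[zw _].
  have w0 := lt_le_trans z0 zw; eexists.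
    apply: derivB; first by apply: deriv_excess; rewrite ltW.
    by apply: derivZ; exact: deriv_id.
  rewrite mulr1 subr_ge0 /d -!addrA lerD2l -ler_expR.
  rewrite !expRB !lnK ?posrE; [|lra..].
  rewrite ler_pdivrMr; last by lra.
  rewrite mulrAC ler_pdivlMr; last by lra.
  have : r * z <= r * w by rewrite ler_pM2l.
  by lra.
have : d * z < d * y by rewrite ltr_pM2l// /z; lra.
by lra.
Qed.

Lemma excess_le (r x y : R) : 0 < r -> 0 <= x -> x <= y -> excess r x <= excess r y.
Proof.
move=> r0 x0; rewrite le_eqVlt => /predU1P[-> //|xy].
by rewrite ltW// excess_lt.
Qed.

Lemma excess_root (r : R) : 0 < r -> excess r r < 0 ->
  exists2 x, r < x & excess r x = 0.
Proof.
move=> r0 er; pose d := ln (r + 1) + ln (r + 1) - ln (r + r + 1).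
have d0 : 0 < d by exact: excess_deriv_gt0.
(* [excess r] has slope at least [d] beyond [r], so it is nonnegative at [b] *)
pose b := r - excess r r / d.
have rb : r <= b by rewrite /b lerBrDl -lerBrDr subrr ler_pdivrMr// mul0r ltW.
have eb : 0 <= excess r b.
  have : excess r r - d * r <= excess r b - d * b.
    apply: (deriv_nondecr (fun w => excess r w - d * w) r b rb) => w /andP[rw _].
    have w0 := lt_le_trans r0 rw; eexists.
      apply: derivB; first by apply: deriv_excess; rewrite ltW.
      by apply: derivZ; exact: deriv_id.
    rewrite mulr1 subr_ge0 /d -!addrA lerD2l -ler_expR.
    rewrite !expRB !lnK ?posrE; [|lra..].
    rewrite ler_pdivrMr; last by lra.
    rewrite mulrAC ler_pdivlMr; last by lra.
    have : r * r <= r * w by rewrite ler_pM2l.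
    by lra.
  have -> : d * b = d * r - excess r r by rewrite /b; field; rewrite gt_eqF.
  by lra.
have [| |c cab ec] := @IVT R (excess r) r b 0 rb.
- apply: derivable_within_continuous => x; rewrite in_itv/= => /andP[rx _].
  have x0 : 0 <= x by rewrite (le_trans (ltW r0)).
  exact: (@ex_derive _ _ _ _ _ _ _ (deriv_excess r x (ltW r0) x0)).
- by apply/andP; split; [rewrite ge_min (ltW er) | rewrite le_max eb orbT].
exists c => //; move: cab; rewrite in_itv/= => /andP[rc _].
rewrite lt_neqAle rc andbT; apply/eqP => E.
by move: er; rewrite -{1}ec -E ltxx.
Qed.

End Quotient.

(** * Numerical bounds on the minimum *)

Section Points.
Context {R : realType}.
Implicit Types (x y t p q a b c m : R) (r s u : nat).

Lemma ler_ln_powers (i j : nat) a b : 0 < a -> 0 < b -> a ^+ i <= b ^+ j ->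
  i%:R * ln a <= j%:R * ln b.
Proof.
move=> a0 b0 h; rewrite !mulr_natl -!lnXn//.
by rewrite ler_ln ?posrE ?exprn_gt0.
Qed.

(** In each row a rational point just below the zero of [excess r] is enough: it
    gives the lower bounds [17 / 22], [5 / 7] and [(2 m + 5) / (4 m + 3)], where
    [m = r + 1], through [log_quot_ge_ratio]. *)
Lemma excess_at_one : excess 1 (12 / 5 : R) <= 0.
Proof.
have h : 17%:R * ln (34 / 5 : R) <= 22%:R * ln (22 / 5 : R).
  by apply: ler_ln_powers; lra.
rewrite /excess -lnM ?posrE; [|lra..].
have -> : (1 + 1) * (12 / 5 + 1) = 34 / 5 :> R by lra.
have -> : 1 + 12 / 5 + 1 = 22 / 5 :> R by lra.
by move: h; lra.
Qed.

Lemma excess_at_two : excess 2 (4 : R) <= 0.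
Proof.
have h : 5%:R * ln (15 : R) <= 7%:R * ln (7 : R).
  by apply: ler_ln_powers; lra.
rewrite /excess -lnM ?posrE; [|lra..].
have -> : (2 + 1) * (4 + 1) = 15 :> R by lra.
have -> : 2 + 4 + 1 = 7 :> R by lra.
by move: h; lra.
Qed.

Lemma excess_at_three : excess 3 (3 + 5 / 2 : R) <= 0.
Proof.
have h : 13%:R * ln (26 : R) <= 19%:R * ln (19 / 2 : R).
  by apply: ler_ln_powers; lra.
rewrite /excess -lnM ?posrE; [|lra..].
have -> : (3 + 1) * (3 + 5 / 2 + 1) = 26 :> R by lra.
have -> : 3 + (3 + 5 / 2) + 1 = 19 / 2 :> R by lra.
by move: h; lra.
Qed.

Lemma excess_large x : 4 <= x -> excess x (x + 5 / 2) <= 0.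
Proof.
(* With [c = (x + 1) + 5 / 4] the product [(x + 1) (x + 7 / 2)] is at most
   [c ^ 2] and [x + (x + 5 / 2) + 1 = 2 c - 1]; then [ln c] is bounded by its
   tangent at 8. *)
move=> x4; pose c := x + 9 / 4.
have c0 : 0 < c by rewrite /c; lra.
have c1 : 0 < 2 * c - 1 by rewrite /c; lra.
rewrite /excess subr_le0.
have -> : x + (x + 5 / 2) + 1 = 2 * c - 1 by rewrite /c; lra.
have lo : ln 2 + ln c - (2 * c - 1)^-1 <= ln (2 * c - 1).
  have := ln_le_subr1 _ (divr_gt0 (mulr_gt0 (ltr0n R 2) c0) c1).
  rewrite ln_div ?lnM ?posrE ?mulr_gt0//.
  have -> : 2 * c / (2 * c - 1) - 1 = (2 * c - 1)^-1 by field; rewrite gt_eqF.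
  by lra.
have {}lo : (2 * c - 1) * (ln 2 + ln c) - 1 <= (2 * c - 1) * ln (2 * c - 1).
  rewrite -(ler_pM2l c1) in lo; apply: le_trans lo.
  by rewrite mulrBr mulfV// gt_eqF.
apply: le_trans lo.
have hi : ln (x + 1) + ln (x + 5 / 2 + 1) <= 2 * ln c.
  rewrite -lnM ?posrE; [|lra..].
  rewrite (mulr_natl (ln c) 2) -lnXn// ler_ln ?posrE ?exprn_gt0//; last first.
    by apply: mulr_gt0; lra.
  by rewrite /c; lra.
have lc : ln c <= 3 * ln 2 + c / 8 - 1.
  have c8 : 0 < c / 8 by rewrite divr_gt0.
  have := ln_le_subr1 _ c8.
  rewrite ln_div ?posrE//.
  have -> : ln (8 : R) = 3 * ln 2.
    by rewrite (mulr_natl (ln 2) 3) -lnXn//; congr ln; lra.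
  by lra.
have l2 : 69 / 100 <= ln (2 : R) := ln2_ge.
have hi2 : (x + 5 / 2 + 1) * (ln (x + 1) + ln (x + 5 / 2 + 1)) <=
   (2 * c + 5 / 2) * ln c.
  apply: (@le_trans _ _ ((x + 5 / 2 + 1) * (2 * ln c))).
    by rewrite ler_wpM2l//; lra.
  by rewrite /c; lra.
apply: le_trans hi2 _.
have k : (2 * c - 23 / 2) * (69 / 100) <= (2 * c - 23 / 2) * ln 2.
  by rewrite ler_wpM2l// /c; lra.
move: k lc; rewrite /c; lra.
Qed.

Lemma excess_row_ge3 r : (3 <= r)%N -> excess (r%:R : R) (r%:R + 5 / 2) <= 0.
Proof.
rewrite leq_eqVlt => /predU1P[<-|r4]; first exact: excess_at_three.
by apply: excess_large; rewrite ler_nat.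
Qed.

(** The zero of [excess r] is at least [r + 1]; hence [a_quot R r] decreases from
    [r] to [r + 1], which is what the comparison of consecutive rows uses. *)
Lemma excess_succ r : (0 < r)%N -> excess (r%:R : R) (r%:R + 1) <= 0.
Proof.
move=> r0; have rp : 0 < r%:R :> R by rewrite ltr0n.
have step y : r%:R + 1 <= y -> excess r%:R y <= 0 -> excess (r%:R : R) (r%:R + 1) <= 0.
  by move=> h; apply: le_trans; apply: excess_le => //; lra.
case: r r0 rp step => [|[|[|r]]]// _ rp step.
- by apply: (step (12 / 5)); [lra | exact: excess_at_one].
- by apply: (step 4); [lra | exact: excess_at_two].
- by apply: (step (r.+3%:R + 5 / 2)); [lra | exact: excess_row_ge3].
Qed.

Lemma excess_diag r : (0 < r)%N -> excess (r%:R : R) r%:R < 0.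
Proof.
move=> r0; have rp : 0 < r%:R :> R by rewrite ltr0n.
by apply: lt_le_trans (excess_succ r r0); apply: excess_lt; lra.
Qed.

Lemma a_quotE r s : a_quot R r s = log_quot r%:R s%:R.
Proof. by rewrite /a_quot /log_quot !natrD. Qed.

Lemma a_quotC r s : a_quot R r s = a_quot R s r.
Proof. by rewrite /a_quot (addnC r s) (addrC (ln (r + 1)%:R)). Qed.

Lemma below_quotP r p : (0 < r)%N ->
  (forall u, (r <= u)%N -> p <= a_quot R r u) <-> below_quot r p.
Proof.
move=> r0; split=> H u ru; have := H u ru.
all: rewrite /a_quot ler_pdivlMr ?addn1//.
all: by rewrite ltr_wpDr ?ln_ge0 ?ln_gt0 ?ler1n ?ltr1n//.
Qed.

Lemma a_quot_ge x r u : (0 < r)%N -> 0 <= x -> excess r%:R x <= 0 ->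
  (x + 1) / (r%:R + x + 1) <= a_quot R r u.
Proof. by move=> r0 x0 ex; rewrite a_quotE log_quot_ge_ratio// ltr0n. Qed.

(** Upper bounds on [p] come from the entries [a_quot R 1 2], [a_quot R 2 4] and
    [a_quot R r (r + 2)]. *)
Lemma admissible_min r s u0 p : (0 < r)%N -> (r <= s)%N -> (r <= u0)%N ->
  p = a_quot R r u0 -> (forall u, (r <= u)%N -> p <= a_quot R r u) ->
  admissible r s p.
Proof.
move=> r0 rs ru0 pE /below_quotP-/(_ r0) bq.
have low x : 0 <= x -> excess r%:R x <= 0 -> (x + 1) / (r%:R + x + 1) <= p.
  by move=> x0 ex; rewrite pE a_quot_ge.
case: r r0 rs ru0 pE bq low => [|[|[|r]]]// _ rs ru0 pE bq low.
- have b2 := bq 2%N isT.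
  have h1 : 31%:R * ln (4 : R) <= 24%:R * ln (6 : R).
    by apply: ler_ln_powers; lra.
  have l6 : 0 < ln (6 : R) by rewrite ln_gt0//; lra.
  apply: admissible_row_one => //.
    have x0 : 0 <= 12 / 5 :> R by lra.
    by apply: le_trans (low _ x0 excess_at_one); rewrite ler_pdivlMr; lra.
  move: b2; rewrite -lnM ?posrE//.
  have -> : (2 : R) * 3 = 6 by lra.
  rewrite (_ : (1 + 2).+1 = 4%N)// => b2.
  have : p * ln 6 <= 24 / 31 * ln 6 by move: b2 h1; lra.
  by rewrite ler_pM2r.
- have b4 := bq 4%N isT.
  have h1 : 25%:R * ln (7 : R) <= 18%:R * ln (15 : R).
    by apply: ler_ln_powers; lra.
  have l15 : 0 < ln (15 : R) by rewrite ln_gt0//; lra.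
  have p18 : p <= 18 / 25.
    move: b4; rewrite -lnM ?posrE//.
    have -> : (3 : R) * 5 = 15 by lra.
    rewrite (_ : (2 + 4).+1 = 7%N)// => b4.
    have : p * ln 15 <= 18 / 25 * ln 15 by move: b4 h1; lra.
    by rewrite ler_pM2r.
  have p57 : 5 / 7 <= p 
    by apply: le_trans (low 4 (ler0n _ 4) excess_at_two); rewrite ler_pdivlMr; lra.
  apply: (admissible_row_large 2%N s p (3 / 8)) => //; [lra|lra|apply/andP; split; lra| |].
    by apply: threshold_two => //; lra.
  move=> b hb.
  have e1 : expR (-1) <= 3 / 8 :> R.
    have : 8 / 3 <= expR 1 :> R.
      have := @expR_ge_taylor R 4 1 ler01.
      rewrite /index_iota unlock /= !factS fact0.
      by apply: le_trans; lra.
    have E : expR (-1) * expR 1 = 1 :> R by rewrite -expRD addNr expR0.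
    rewrite -(@ler_pM2l _ (expR (-1))) ?expR_gt0// E.
    by lra.
  have : -1 < - (2 * b) by rewrite -ltr_expR (le_lt_trans e1).
  by lra.
set m : R := r.+4%:R.
have m4 : 4 <= m by rewrite ler_nat.
have p_low : 2 * m + 5 <= (4 * m + 3) * p.
  have x0 : 0 <= r.+3%:R + 5 / 2 :> R by rewrite addr_ge0//; lra.
  have := low _ x0 (excess_row_ge3 r.+3 isT).
  have -> : r.+3%:R = m - 1 by rewrite /m -(natr1 r.+3); lra.
  rewrite ler_pdivrMr; last by lra.
  by lra.
have p_up : p * (ln m + ln (m + 2)) <= ln (2 * m + 1).
  have := bq r.+3.+2 (leqW (leqW (leqnn _))).
  rewrite -/m.
  have -> : r.+3.+3%:R = m + 2 by rewrite /m -(natr1 r.+3.+2) -(natr1 r.+4); lra.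
  have -> : (r.+3 + r.+3.+2).+1%:R = 2 * m + 1 :> R.
    by rewrite /m -natrM -[1]/(1%:R) -natrD; congr (_%:R); lia.
  by [].
have p34 : p <= 3 / 4.
  have l0 : 0 < ln m + ln (m + 2) by rewrite addr_gt0// ln_gt0; lra.
  have : 4%:R * ln (2 * m + 1) <= 3%:R * ln (m * (m + 2)).
    apply: ler_ln_powers; [lra|by rewrite mulr_gt0; lra|].
    have [k k0 ->] : exists2 k, 0 <= k & m = 4 + k by exists (m - 4); lra.
    have k2 : 0 <= k ^+ 2 by rewrite exprn_ge0.
    have k3 : 0 <= k ^+ 3 by rewrite exprn_ge0.
    have k4 : 0 <= k ^+ 4 by rewrite exprn_ge0.
    have k5 : 0 <= k ^+ 5 by rewrite exprn_ge0.
    have k6 : 0 <= k ^+ 6 by rewrite exprn_ge0.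
    by move: k0 k2 k3 k4 k5 k6; lra.
  rewrite lnM ?posrE; [|lra..] => h.
  have : p * (ln m + ln (m + 2)) <= 3 / 4 * (ln m + ln (m + 2)).
    by move: p_up h; lra.
  by rewrite ler_pM2r.
have m0 : 0 < m + 1 by lra.
apply: (admissible_row_large r.+3 s p (expR (- (2 * (2 / (m + 1)))))) => //.
- by rewrite -/m; lra.
- by rewrite expR_gt0 expR_lt1 oppr_lt0 mulr_gt0// divr_gt0.
- exact: (threshold_large m p).
move=> b; rewrite -/m ltr_expR ltrN2 ltr_pM2l// ltr_pdivlMr// => h.
by rewrite mulrC ltW.
Qed.

End Points.

(** * The infimum and the minimum *)

Section Extremal.
Context {R : realType}.
Implicit Types (x y t p q a b c m : R) (r s u k : nat).

(** For [u > r], [a_quot R r u] and [a_quot R r.+1 u] are consecutive entries of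
    row [u], in the range where that row decreases. *)
Lemma a_quot_lower_row r c : (0 < r)%N ->
  (forall u, (r < u)%N -> c <= a_quot R r.+1 u) ->
  forall u, (r <= u)%N -> c <= a_quot R r u.
Proof.
move=> r0 H.
have gt u : (r < u)%N -> c <= a_quot R r u.
  move=> ru; apply: le_trans (H u ru) _.
  have u0 : 0 < u%:R :> R by rewrite ltr0n (leq_trans _ ru).
  rewrite a_quotC (a_quotC r) !a_quotE.
  apply: log_quot_decr => //; first by rewrite ler_nat.
  apply: le_trans (excess_succ u (leq_trans (ltn0Sn r) ru)).
  by apply: excess_le => //; rewrite natr1 ler_nat ltnW.
move=> u; rewrite leq_eqVlt => /predU1P[<-|]; last exact: gt.
apply: le_trans (gt r.+1 (ltnSn r)) _; rewrite !a_quotE.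
apply: log_quot_decr; [by rewrite ltr0n|by []|by rewrite ler_nat|].
by rewrite -natr1 excess_succ.
Qed.

Lemma a_quot_lower_rows s r c : (0 < s)%N -> (s <= r)%N ->
  (forall u, (r <= u)%N -> c <= a_quot R r u) ->
  forall u, (s <= u)%N -> c <= a_quot R s u.
Proof.
move=> s0 /subnK <-; elim: (r - s)%N => [//|n IH] H.
apply: IH; apply: a_quot_lower_row; first by rewrite addn_gt0 s0 orbT.
exact: H.
Qed.

(** Row [r] decreases up to the zero of [excess r] and increases afterwards. *)
Lemma a_quot_min_floor r x : (0 < r)%N -> r%:R < x -> excess r%:R x = 0 ->
  let k := `|Num.floor x|%N in
  (r <= k)%N /\ forall u, (r <= u)%N ->
     Num.min (a_quot R r k) (a_quot R r k.+1) <= a_quot R r u.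
Proof.
move=> r0 rx ex k.
have rp : 0 < r%:R :> R by rewrite ltr0n.
have x0 : 0 <= x by rewrite ltW// (lt_trans rp).
have kE : k%:R = (Num.floor x)%:~R :> R.
  by rewrite /k -mulrz_nat natz gez0_abs// floor_ge0.
have kx : k%:R <= x by rewrite kE floor_le_tmp.
have xk : x < k.+1%:R.
  by rewrite -natr1 kE -[1]/(1%:~R) -intrD floorD1_gt.
have rk : (r <= k)%N by rewrite -ltnS -(ltr_nat R) (lt_trans rx).
split=> // u ru; rewrite ge_min.
have [uk|ku] := leqP u k.
  apply/orP; left; rewrite !a_quotE log_quot_decr// ?ler_nat//.
  by rewrite -ex excess_le.
apply/orP; right; rewrite !a_quotE log_quot_incr// ?ler_nat//.
by rewrite -ex excess_le// ltW.
Qed.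

Lemma sigma_exists r : (0 < r)%N -> exists2 x : R, r%:R < x & excess r%:R x = 0.
Proof. by move=> r0; apply: excess_root; [rewrite ltr0n | exact: excess_diag]. Qed.

Lemma a_quot_min_exists r : (0 < r)%N ->
  exists2 u0, (r <= u0)%N & forall u, (r <= u)%N -> a_quot R r u0 <= a_quot R r u.
Proof.
move=> r0; have [x rx ex] := sigma_exists r r0.
have [/= rk H] := a_quot_min_floor r x r0 rx ex.
move: rk H; set k := `|_|%N => rk H.
case: (leP (a_quot R r k) (a_quot R r k.+1)) H => _ H.
  by exists k.
by exists k.+1 => //; exact: leqW.
Qed.

Lemma admissibleC r s p : admissible r s p -> admissible s r p.
Proof.
case=> [->|[p0 H]]; [by left | right; split=> // t t0 t1].
by rewrite mulrC addnC; exact: H.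
Qed.

(** The smaller of [r] and [s] plays the role of the row index; passing to it is
    allowed because lower bounds of a row are lower bounds of the previous ones. *)
Lemma max_exponent_ge r s c : (0 < r)%N -> (0 < s)%N ->
  (forall u, (r <= u)%N -> c <= a_quot R r u) -> c <= max_exponent R r s.
Proof.
have main (q1 q2 : nat) : (0 < q1)%N -> (q1 <= q2)%N ->
    (forall u, (q1 <= u)%N -> c <= a_quot R q1 u) ->
    exists2 p, c <= p & admissible q1 q2 p.
  move=> q10 q12 H; have [u0 u1 U] := a_quot_min_exists q1 q10.
  by exists (a_quot R q1 u0); [exact: H | exact: admissible_min (erefl _) U].
move=> r0 s0 H; have [_ ub] := @max_exponentP R r s r0.
have [rs|/ltnW sr] := leqP r s.
  by have [p cp /ub/(le_trans cp)] := main r s r0 rs H.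
have [p cp ap] := main s r s0 sr (a_quot_lower_rows s r c s0 sr H).
exact: le_trans cp (ub p (admissibleC _ _ _ ap)).
Qed.

Lemma C_infE r k : (0 < r)%N -> (r <= k)%N ->
  (forall u, (r <= u)%N -> a_quot R r k <= a_quot R r u) ->
  C_inf R r = a_quot R r k.
Proof.
move=> r0 rk H; apply/eqP; rewrite eq_le; apply/andP; split.
  apply: (@le_trans _ _ (max_exponent R r k)); last first.
    by apply: admissible_le => //; have [] := @max_exponentP R r k r0.
  apply: ge_inf; last by exists k => //=; exact: leq_trans rk.
  exists (a_quot R r k) => _ [s /= s0 <-]; exact: max_exponent_ge.
apply: lb_le_inf; first by exists (max_exponent R r 1), 1%N.
by move=> _ [s /= s0 <-]; exact: max_exponent_ge.
Qed.

Lemma is_sigmaE r x : (0 < r)%N ->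
  is_sigma r x <-> r%:R < x /\ excess r%:R x = 0.
Proof.
move=> r0; have rp : 0 < r%:R :> R by rewrite ltr0n.
rewrite /is_sigma /excess; split=> -[rx E]; split=> //; have x0 := lt_trans rp rx.
  by rewrite -lnM ?posrE ?addr_gt0// E subrr.
by apply/eqP; rewrite -subr_eq0 lnM ?posrE ?addr_gt0// E.
Qed.

Lemma inf_log_quot a x : 0 < a -> a < x -> excess a x = 0 ->
  inf [set log_quot a y | y in [set y : R | a <= y]] = (x + 1) / (a + x + 1).
Proof.
move=> a0 ax ex; have x0 := ltW (lt_trans a0 ax).
have H y : a <= y -> (x + 1) / (a + x + 1) <= log_quot a y.
  by move=> ay; apply: log_quot_ge_ratio => //; [exact: le_trans (ltW a0) ay | rewrite ex].
apply/eqP; rewrite eq_le; apply/andP; split.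
  rewrite -log_quot_ratio//; apply: ge_inf; last by exists x => //=; exact: ltW.
  by exists ((x + 1) / (a + x + 1)) => _ [y /= ay <-]; exact: H.
by apply: lb_le_inf; [exists (log_quot a x), x => //=; exact: ltW |
  move=> _ [y /= ay <-]; exact: H].
Qed.

End Extremal.

Theorem theorem1p2 (R : realType) (r : nat) (r_gt0 : (0 < r)%N) :
  is_minimum [set a_quot R r s | s in [set s : nat | (r <= s)%N]] (C_inf R r) /\
  exists sigma : R,
    [/\ is_sigma r sigma,
        forall tau : R, is_sigma r tau -> tau = sigma,
        (let k := `|Num.floor sigma|%N in
         C_inf R r = Num.min (a_quot R r k) (a_quot R r k.+1))
      & inf [set ln (r%:R + x + 1) / (ln (r%:R + 1) + ln (x + 1))
            | x in [set x : R | r%:R <= x]]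
        = (sigma + 1) / (r%:R + sigma + 1)].
Proof.
have rp : 0 < r%:R :> R by rewrite ltr0n.
split.
  have [k rk H] := @a_quot_min_exists R r r_gt0.
  rewrite (C_infE r k r_gt0 rk H); split; first by exists k.
  by move=> _ [u /= ru <-]; exact: H.
have [x rx ex] := @sigma_exists R r r_gt0; exists x; split.
- by apply/is_sigmaE.
- move=> y /is_sigmaE-/(_ r_gt0)[ry ey].
  have [yx|xy|//] := ltgtP y x.
    by have := excess_lt r%:R y x rp (ltW (lt_trans rp ry)) yx; rewrite ex ey ltxx.
  by have := excess_lt r%:R x y rp (ltW (lt_trans rp rx)) xy; rewrite ex ey ltxx.
- have [/= rk H] := a_quot_min_floor r x r_gt0 rx ex.
  move: rk H; set k := `|_|%N => rk H.
  case: (leP (a_quot R r k) (a_quot R r k.+1)) H => _ H.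
    exact: C_infE.
  by apply: C_infE => //; exact: leqW.
- exact: inf_log_quot.
Qed.
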